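(* (1) An interval in $\mathbb{R}$ can be reconstructed using $5$ test sets. (2) A ball in $\mathbb{R}^d$ can be reconstructed using $2d+3$ test sets. (3) An $n$-gon in $\mathbb{R}^2$ can be reconstructed using $4n+1$ test sets. (4) An axis-parallel rectangle in $\mathbb{R}^2$ can be reconstructed using $9$ test sets. (5) An ellipsoid in $\mathbb{R}^3$ can be reconstructed using $19$ test sets. (6) A simplex in $\mathbb{R}^d$ can be reconstructed using $2d^2+2d+1$ test sets.
   Context: $\lambda^d$ denotes Lebesgue measure on $\mathbb{R}^d$. For a family $\mathcal{A}$ of Lebesgue measurable subsets of $\mathbb{R}^d$ of finite measure, an element of $\mathcal{A}$ can be reconstructed using $m$ test sets if there exist measurable sets $T_1,\ldots,T_m\subset\mathbb{R}^d$ such that whenever $A,B\in\mathcal{A}$ and $\lambda^d(A\cap T_i)=\lambda^d(B\cap T_i)$ for every $i=1,\ldots,m$, then $A=B$. In each item the family consists of all objects of the named type in the given space (with $n\ge 3$ fixed in (3), $d\ge1$ fixed in (2) and (6)). All objects are understood as closed, bounded, nondegenerate solid bodies: intervals are bounded nondegenerate closed intervals, balls are closed balls of positive radius, an $n$-gon is the closed region of the plane bounded by a simple closed polygon with $n$ vertices, rectangles and ellipsoids are closed solid and nondegenerate, and a simplex in $\mathbb{R}^d$ is the convex hull of $d+1$ affinely independent points. *)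

(* Defs.v *)
From mathcomp Require Import all_boot all_order all_algebra.
From mathcomp Require Import all_classical all_reals all_analysis.

Set Implicit Arguments.
Unset Strict Implicit.
Unset Printing Implicit Defensive.

Import Order.TTheory GRing.Theory Num.Theory.
Import numFieldNormedType.Exports.

Local Open Scope classical_set_scope.
Local Open Scope ring_scope.

(* R^d is 'rV[R]_d.  Its library norm is the sup norm, so the Euclidean norm is
   defined here; the topology and the bounded sets are the same. *)
Definition enorm (R : realType) (d : nat) (x : 'rV[R]_d) : R :=
  Num.sqrt (\sum_(i < d) x 0 i ^+ 2).

(* Half-open boxes, as for the generators of the library's lebesgue_measure;
   the box is empty and has volume 0 as soon as b 0 i <= a 0 i for some i. *)
Definition hobox (R : realType) (d : nat) (a b : 'rV[R]_d) : set 'rV[R]_d :=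
  [set x | forall i, a 0 i < x 0 i <= b 0 i].

Definition box_volume (R : realType) (d : nat) (a b : 'rV[R]_d) : R :=
  \prod_(i < d) Num.max (b 0 i - a 0 i) 0.

(* Lebesgue measure, extended to all subsets of R^d as Lebesgue outer measure.
   The Lebesgue measurable sets are its Caratheodory measurable sets.  In the
   same way, the library's lebesgue_measure is defined on all subsets of R, and
   is Lebesgue outer measure there. *)
Definition lebesgue_measure_rV (R : realType) (d : nat) (A : set 'rV[R]_d) :
    \bar R :=
  ereal_inf [set s | exists a b : nat -> 'rV[R]_d,
    A `<=` \bigcup_k hobox (a k) (b k) /\
    s = (\sum_(0 <= k <oo) (box_volume (a k) (b k))%:E)%E].

(* Used with mu a Lebesgue (outer) measure, so that "Caratheodory measurable"
   means "Lebesgue measurable". *)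
Definition reconstructible (R : realType) (X : Type) (mu : set X -> \bar R)
    (F : set (set X)) (m : nat) : Prop :=
  exists T : 'I_m -> set X,
    (forall i, caratheodory_measurable mu (T i)) /\
    (forall A B, F A -> F B ->
       (forall i, mu (A `&` T i) = mu (B `&` T i)) -> A = B).

Definition intervals (R : realType) : set (set R) :=
  [set A | exists a b : R, a < b /\ A = `[a, b]%classic].

Definition balls (R : realType) (d : nat) : set (set 'rV[R]_d) :=
  [set A | exists (c : 'rV[R]_d) (r : R),
     0 < r /\ A = [set x : 'rV[R]_d | enorm (x - c) <= r]].

Definition segment_point (R : realType) (d : nat) (p q : 'rV[R]_d) (t : R) :
    'rV[R]_d :=
  (1 - t) *: p + t *: q.

(* The closed polygonal line through p 0, ..., p (n - 1), p 0;
   ordS is the cyclic successor on 'I_n. *)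
Definition polygon_curve (R : realType) (n : nat) (p : 'I_n -> 'rV[R]_2) :
    set 'rV[R]_2 :=
  [set x | exists (i : 'I_n) (t : R),
     0 <= t <= 1 /\ x = segment_point (p i) (p (ordS i)) t].

(* The closed curve is traversed injectively, each edge being taken without its
   final point; in particular the vertices are distinct.  A vertex may have a
   straight angle. *)
Definition simple_polygon (R : realType) (n : nat) (p : 'I_n -> 'rV[R]_2) :
    Prop :=
  forall (i j : 'I_n) (s t : R), 0 <= s < 1 -> 0 <= t < 1 ->
    segment_point (p i) (p (ordS i)) s = segment_point (p j) (p (ordS j)) t ->
    i = j /\ s = t.

(* The curve together with the bounded components of its complement. *)
Definition polygon_region (R : realType) (n : nat) (p : 'I_n -> 'rV[R]_2) :
    set 'rV[R]_2 :=
  polygon_curve p `|`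
  [set x | ~ polygon_curve p x /\
           bounded_set (connected_component (~` polygon_curve p) x)].

Definition polygons (R : realType) (n : nat) : set (set 'rV[R]_2) :=
  [set A | exists p : 'I_n -> 'rV[R]_2,
     simple_polygon p /\ A = polygon_region p].

Definition axis_rectangles (R : realType) : set (set 'rV[R]_2) :=
  [set A | exists a b : 'rV[R]_2, (forall i, a 0 i < b 0 i) /\
     A = [set x : 'rV[R]_2 | forall i, a 0 i <= x 0 i <= b 0 i]].

Definition quadratic_form (R : realType) (d : nat) (Q : 'M[R]_d)
    (x : 'rV[R]_d) : R :=
  (x *m Q *m x^T) 0 0.

Definition positive_definite (R : realType) (d : nat) (Q : 'M[R]_d) : Prop :=
  Q^T = Q /\ forall x : 'rV[R]_d, x != 0 -> 0 < quadratic_form Q x.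

Definition ellipsoids (R : realType) (d : nat) : set (set 'rV[R]_d) :=
  [set A | exists (c : 'rV[R]_d) (Q : 'M[R]_d), positive_definite Q /\
     A = [set x : 'rV[R]_d | quadratic_form Q (x - c) <= 1]].

Definition affinely_independent (R : realType) (d k : nat)
    (p : 'I_k -> 'rV[R]_d) : Prop :=
  forall c : 'I_k -> R,
    \sum_(i < k) c i = 0 -> \sum_(i < k) c i *: p i = 0 -> forall i, c i = 0.

Definition convex_hull (R : realType) (d k : nat) (p : 'I_k -> 'rV[R]_d) :
    set 'rV[R]_d :=
  [set x | exists c : 'I_k -> R, (forall i, 0 <= c i) /\
     \sum_(i < k) c i = 1 /\ x = \sum_(i < k) c i *: p i].

Definition simplices (R : realType) (d : nat) : set (set 'rV[R]_d) :=
  [set A | exists p : 'I_d.+1 -> 'rV[R]_d,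
     affinely_independent p /\ A = convex_hull p].

(* Main.v *)
(* Menger-Noebeling by hand.  For a family with k parameters, the pairs of its
   members have 2k parameters, so the vectors of differences of the overlaps of
   two members with 2k+1 test sets form a set of covering dimension 2k in
   R^(2k+1).  Two distinct members differ on some rational box; replacing the
   test sets inside a tiny part of that box by sub-boxes of prescribed volumes
   translates the difference vector by an arbitrary small vector, and a
   pigeonhole argument finds a translation that keeps it away from 0 uniformly
   for all pairs differing on that box.  Running through the countably many
   boxes with rapidly decreasing perturbations gives test sets in the limit.

   The covering bound needs only that the members depend on the parameters in a
   Lipschitz way for the measure of the symmetric difference.  For balls,
   ellipsoids, rectangles and simplices, written as {x | f_j(x) <= 1} with f_j
   homogeneous around a center, the symmetric difference lies in a thin shell
   between two dilates.  A polygonal region is, up to the lines through its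
   edges, a union of sign cells of these lines; there are finitely many sets of
   sign vectors, so that no stability of the bounded components under
   perturbation is needed.  That a polygonal region is the closure of its
   interior follows from the parity of the number of crossings with a ray. *)

From HB Require Import structures.
Require Import Defs.
From mathcomp Require Import all_boot all_order all_algebra.
From mathcomp Require Import all_classical all_reals all_analysis.
From mathcomp Require Import measurable_realfun ring lra zify.

Set Implicit Arguments.
Unset Strict Implicit.
Unset Printing Implicit Defensive.

Import Order.TTheory GRing.Theory Num.Theory.
Import numFieldNormedType.Exports.

Local Open Scope classical_set_scope.
Local Open Scope ring_scope.

(** * Perturbing test sets *)

(** If a box lies in [A] minus [B], replacing a test set inside the box by a part of measure t makes
    the overlap difference t plus a quantity independent of that part. This exact translation needs
    a box contained in one of the two differences, which is why the families must consist of closed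
    sets contained in the closure of their interior, or be treated directly, as the intervals are.
    At scale 1/K there are of the order of K^(2k) pairs of net points against K^m grid translations;
    this is where m > 2k enters. The six numbers are 2k + 1 with k = 2, d + 1, 2n, 4, 9 and d(d +
    1). No finite net serves a whole family: members are arbitrarily large, and the Lipschitz
    constants degenerate for thin ones. Each family is therefore exhausted by countably many
    subfamilies with bounded parameters. The nets consist of arbitrary sets rather than members, so
    that perturbed parameters may leave the family. *)

Definition covered_with_exponent (R : realType) (X : Type)
    (mu : set X -> \bar R) (k : nat) (G : set (set X)) : Prop :=
  exists C : nat, forall K : nat, (0 < K)%N ->
    exists (I : finType) (D : I -> set X), (#|I| <= C * K ^ k)%N /\
      forall A, G A -> exists i, (mu (A `+` D i) <= (K%:R^-1)%:E)%E.

Definition overlap (R : realType) (X : Type) (mu : set X -> \bar R)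
    (A T : set X) : R := fine (mu (A `&` T)).

Lemma outer_fin (R : realType) (X : Type) (mu : {outer_measure set X -> \bar R})
    (A B : set X) :
  A `<=` B -> (mu B < +oo)%E -> mu A \is a fin_num.
Proof.
move=> AB mB; rewrite ge0_fin_numE ?outer_measure_ge0//.
by apply: le_lt_trans mB; exact: le_outer_measure.
Qed.

Lemma fine_outer_dist (R : realType) (X : Type)
    (mu : {outer_measure set X -> \bar R}) (A B : set X) (e : R) :
  (mu A < +oo)%E -> (mu B < +oo)%E -> (mu (A `+` B) <= e%:E)%E ->
  `|fine (mu A) - fine (mu B)| <= e.
Proof.
have key (C D : set X) : (mu C < +oo)%E -> (mu D < +oo)%E ->
    (mu (C `+` D) <= e%:E)%E -> fine (mu C) - fine (mu D) <= e.
  move=> mC mD h; rewrite lerBlDl -lee_fin EFinD.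
  rewrite !fineK ?(outer_fin (@subset_refl _ _))//.
  apply: le_trans (leeD2l (mu D) h).
  apply: le_trans (outer_measureU2 mu D (C `+` D)).
  apply: le_outer_measure => x Cx.
  by have [Dx|nDx] := pselect (D x); [left|right; left].
move=> mA mB h; rewrite ler_norml lerNl opprB !key//.
by rewrite setYC.
Qed.

Lemma overlap_distl (R : realType) (X : Type)
    (mu : {outer_measure set X -> \bar R}) (A B T : set X) (e : R) :
  (mu T < +oo)%E -> (mu (A `+` B) <= e%:E)%E ->
  `|overlap mu A T - overlap mu B T| <= e.
Proof.
move=> mT h; have ltT (C : set X) : (mu (C `&` T) < +oo)%E.
  by apply: le_lt_trans mT; apply: le_outer_measure; exact: subIsetr.
apply: fine_outer_dist => //; apply: le_trans h.
apply: le_outer_measure => x.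
by move=> [[[Ax Tx] nBT]|[[Bx Tx] nAT]]; [left|right]; split=> // ?;
  [apply: nBT|apply: nAT].
Qed.

Lemma overlap_distr (R : realType) (X : Type)
    (mu : {outer_measure set X -> \bar R}) (A T T' : set X) (e : R) :
  (mu T < +oo)%E -> (mu T' < +oo)%E -> (mu (T `+` T') <= e%:E)%E ->
  `|overlap mu A T - overlap mu A T'| <= e.
Proof.
move=> mT mT' h; have ltT (S : set X) : (mu S < +oo)%E ->
    (mu (A `&` S) < +oo)%E.
  by apply: le_lt_trans; apply: le_outer_measure; exact: subIsetr.
apply: fine_outer_dist; [exact: ltT|exact: ltT|].
apply: le_trans h; apply: le_outer_measure => x.
by move=> [[[Ax Tx] n]|[[Ax Tx] n]]; [left|right]; split=> // ?; apply: n.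
Qed.

(* Replacing [T] on [W] by a subset [S] of [W] changes the overlap difference
   of two sets separated by [W] by a number at our disposal, [mu S]. *)
Lemma overlap_replace (R : realType) (X : Type)
    (mu : {outer_measure set X -> \bar R}) (A B T W S : set X) :
  (mu T < +oo)%E -> (mu W < +oo)%E ->
  caratheodory_measurable mu W -> S `<=` W -> W `<=` A `\` B ->
  overlap mu A ((T `\` W) `|` S) - overlap mu B ((T `\` W) `|` S) =
  fine (mu S) + (overlap mu A (T `\` W) - overlap mu B (T `\` W)).
Proof.
move=> mT mW cW SW WAB.
have fT (C : set X) : mu (C `&` (T `\` W)) \is a fin_num.
  by apply: outer_fin mT => x [_ []].
rewrite /overlap (cW (A `&` _)) (cW (B `&` _)).
have -> : A `&` (T `\` W `|` S) `&` W = S.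
  apply/seteqP; split=> [x [[_ [[_ nW]//|//]]]|x Sx].
  by have := WAB _ (SW _ Sx) => -[Ax _]; split; [split=> //; right|exact: SW].
have -> : A `&` (T `\` W `|` S) `&` ~` W = A `&` (T `\` W).
  apply/seteqP; split=> [x [[Ax [[Tx nW]|/SW]]]//|x [Ax [Tx nWx]]].
  by split=> //; split=> //; left.
have -> : B `&` (T `\` W `|` S) `&` W = set0.
  by apply/seteqP; split=> // x [[Bx _] /WAB[]].
have -> : B `&` (T `\` W `|` S) `&` ~` W = B `&` (T `\` W).
  apply/seteqP; split=> [x [[Ax [[Tx nW]|/SW]]]//|x [Ax [Tx nWx]]].
  by split=> //; split=> //; left.
rewrite outer_measure0 add0e fineD//; last exact: outer_fin SW mW.
ring.
Qed.

(** [(C * (K * Q) ^ k) ^ 2] counts pairs of net points at scale 1/(K * Q), and [K ^ m] the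
    translations on a grid with [K] values per test set. As [Q] is fixed before [K], any [K] above
    [C ^ 2 * Q ^ (2 * k)] works. *)
Lemma pigeonhole_scale (C Q k m : nat) : (2 * k < m)%N -> (0 < Q)%N ->
  exists2 K, (0 < K)%N & ((C * (K * Q) ^ k) ^ 2 < K ^ m)%N.
Proof.
move=> km Q0; exists (C ^ 2 * Q ^ (2 * k)).+1 => //; set K := (C ^ 2 * Q ^ (2 * k))%N.+1.
apply: (@leq_trans (K ^ (2 * k).+1)); last by rewrite leq_pexp2l.
rewrite !expnMn -!expnM (mulnC k 2) (expnS K) mulnCA mulnC ltn_mul2r.
by rewrite expn_gt0 ltnSn.
Qed.

(** If every grid translation left some separated pair nearly undistinguished, each translation
    would select two net points whose difference vector it nearly cancels. The grid is coarser than
    the tolerance, so two net points serve at most one translation, against the count of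
    [pigeonhole_scale]. The factor 4 in the conclusion leaves room for later stages, which move each
    of the two overlaps by at most [2 * tau']. *)
Lemma perturb_test_sets (R : realType) (X : Type)
    (mu : {outer_measure set X -> \bar R}) (k m : nat) (G : set (set X))
    (V : R -> set X) (v tau : R) (T : 'I_m -> set X) :
  (2 * k < m)%N -> covered_with_exponent mu k G ->
  0 < v -> 0 < tau ->
  (forall s : R, 0 <= s <= 1 -> [/\ caratheodory_measurable mu (V s),
     V s `<=` V 1 & mu (V s) = (s * v)%:E]) ->
  (forall i, caratheodory_measurable mu (T i)) ->
  (forall i, mu (T i) < +oo)%E ->
  exists (T' : 'I_m -> set X) (tau' : R),
  [/\ forall i, caratheodory_measurable mu (T' i),
      forall i, (mu (T' i) < +oo)%E,
      forall i, T i `+` T' i `<=` V 1,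
      0 < tau' <= tau / 2 &
      forall A B, G A -> G B -> V 1 `<=` A `\` B ->
        exists i, 4 * tau' < `|overlap mu A (T' i) - overlap mu B (T' i)|].
Proof.
move=> km [C hC] v0 tau0 hV cT mT.
have [|cV1 _ mV1] := hV 1%R; first by rewrite ler01 lexx.
have V1oo : (mu (V 1%R) < +oo)%E by rewrite mV1 ltry.
(* Makes the net error 1/(K * Q) at most the [e] below, whatever [K] is. *)
set Q := (Num.bound (8 / v)).+1.
have [K K0 hK] := pigeonhole_scale C km (isT : (0 < Q)%N).
have KR0 : 0 < K%:R :> R by rewrite ltr0n.
have [|I [D [cardI hD]]] := hC (K * Q)%N; first by rewrite muln_gt0 K0.
(* The shifts have spacing v/K = 8 * e. Near cancellation means up to 3 * e: one [e] for [4 * tau']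
   and one for each of the two net approximations. *)
set e := v / (8 * K%:R).
have e0 : 0 < e by rewrite divr_gt0// mulr_gt0.
have hKQ : (K * Q)%:R^-1 <= e.
  have hQ : 8 / v <= Q%:R.
    apply/ltW/(lt_trans (archi_boundP _)); first by rewrite divr_ge0// ltW.
    by rewrite ltr_nat.
  have -> : e = (K%:R * (8 / v))^-1 by rewrite /e; field; rewrite !gt_eqF.
  rewrite natrM lef_pV2 ?ler_pM2l// posrE mulr_gt0 ?divr_gt0 ?ltr0n//.
pose s (r : {ffun 'I_m -> 'I_K}) i : R := (r i)%:R / K%:R.
have s01 r i : 0 <= s r i <= 1.
  by rewrite divr_ge0//= ler_pdivrMr// mul1r ler_nat ltnW.
pose T' r i := (T i `\` V 1) `|` V (s r i).
set tau' := Num.min (e / 4) (tau / 2).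
have tau'0 : 0 < tau' by rewrite lt_min; apply/andP; split; rewrite divr_gt0.
have tau'e : 4 * tau' <= e.
  have : tau' <= e / 4 by rewrite ge_min lexx.
  lra.
have mTV i : (mu (T i `\` V 1%R) < +oo)%E.
  by apply: le_lt_trans (mT i); apply: le_outer_measure; exact: subDsetl.
pose good r := forall A B, G A -> G B -> V 1 `<=` A `\` B ->
  exists i, 4 * tau' < `|overlap mu A (T' r i) - overlap mu B (T' r i)|.
have [r hr] : exists r, good r.
  apply: contrapT => /forallNP bad.
  have /choice[c hc] : forall r, exists c : I * I,
    forall i, `|s r i * v + (overlap mu (D c.1) (T i `\` V 1) -
                  overlap mu (D c.2) (T i `\` V 1))| <= 3 * e.
    move=> r; have := bad r; rewrite /good.
    move=> /existsNP[A] /existsNP[B] /not_implyP[GA] /not_implyP[GB].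
    move=> /not_implyP[VAB] /forallNP hi.
    have [a ha] := hD _ GA; have [b hb] := hD _ GB.
    exists (a, b) => i /=.
    have /negP := hi i; rewrite -leNgt.
    have [cVs Vs1 mVs] := hV _ (s01 r i).
    rewrite overlap_replace// mVs /=.
    have da := overlap_distl (mTV i) ha; have db := overlap_distl (mTV i) hb.
    move: da db tau'e hKQ; rewrite !ler_norml.
    by move=> /andP[? ?] /andP[? ?] ? ? /andP[? ?]; apply/andP; split; lra.
  suff /leq_card : injective c.
    rewrite card_ffun card_prod !card_ord leqNgt => /negP; apply.
    apply: leq_ltn_trans hK.
    by rewrite mulnn leq_exp2r.
  (* Two translations with the same net points differ by at most 6 * e in each coordinate, which is
     less than one grid step. *)
  move=> r r' cc; apply/ffunP => i.
  have := hc r i; have := hc r' i; rewrite cc.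
  set g := _ - _; rewrite !ler_norml => /andP[h1 h2] /andP[h3 h4].
  have {}h : `|(r i)%:R - (r' i)%:R : R| < 1.
    have ve : v = 8 * K%:R * e by rewrite /e; field; rewrite gt_eqF.
    have E (q : {ffun 'I_m -> 'I_K}) : s q i * v = 8 * (q i)%:R * e.
      by rewrite ve /s; field; rewrite gt_eqF.
    move: h1 h2 h3 h4; rewrite !E ltr_norml => h1 h2 h3 h4.
    by rewrite -(ltr_pM2r e0) -[X in _ && X](ltr_pM2r e0); apply/andP; split; lra.
  apply/val_inj => /=; move: h; move: (nat_of_ord (r i)) (nat_of_ord (r' i)).
  move=> x y; wlog xy : x y / (x <= y)%N.
    move=> w; have [/w//|/ltnW/w {}w] := leqP x y.
    by rewrite distrC => /w.
  rewrite distrC -natrB// normr_nat (ltr_nat R _ 1) => h; lia.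
have TVs i : T' r i `<=` T i `|` V 1.
  move=> x [[]|]; first by left.
  by have [_ + _] := hV _ (s01 r i) => h /h; right.
exists (T' r), tau'; split => //.
- move=> i; apply: caratheodory_measurable_setU.
    exact: caratheodory_measurable_setD.
  by have [] := hV _ (s01 r i).
- move=> i; apply: le_lt_trans (le_outer_measure mu _ _ (TVs i)) _.
  by apply: le_lt_trans (outer_measureU2 _ _ _) _; rewrite lte_add_pinfty.
- move=> i x [[Tx nT']|[T'x nT]].
    by apply: contrapT => n; apply: nT'; left.
  by case: (TVs i x T'x).
- by rewrite tau'0 /= ge_min lexx orbT.
Qed.

(** The tolerances at least halve, so a geometric series bounds all changes made from stage [n] on
    by twice the tolerance of that stage. *)
Lemma outer_tail_le (R : realType) (X : Type)
    (mu : {outer_measure set X -> \bar R}) (W : nat -> set X) (tau : nat -> R)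
    (n : nat) :
  (forall l, 0 <= tau l.+1 <= tau l / 2) -> (forall l, (mu (W l) <= (tau l)%:E)%E) ->
  (mu (\bigcup_l W (n + l)%N) <= (2 * tau n)%:E)%E.
Proof.
move=> htau hW.
have tau_ge0 : 0 <= tau n by have /andP[] := htau n; lra.
apply: le_trans (outer_measure_sigma_subadditive mu (fun l => W (n + l)%N)) _.
have := @epsilon_trick0 R (2 * tau n) xpredT.
rewrite mulr_ge0// => /(_ isT); apply: le_trans.
apply: lee_nneseries => [l _ _|l _]; first exact: outer_measure_ge0.
apply: le_trans (hW _) _; rewrite lee_fin.
elim: l => [|l IH]; first by rewrite addn0 expn1; lra.
have /andP[_ h] := htau (n + l)%N; rewrite addnS; apply: le_trans h _.
have -> : 2 * tau n / (2 ^ l.+2)%:R = (2 * tau n / (2 ^ l.+1)%:R) / 2.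
  by rewrite (expnS 2 l.+1) natrM; field; rewrite natrX expf_neq0.
by rewrite ler_pM2r.
Qed.

(** Linearity in [s] allows a translation of the overlap difference by any prescribed fraction of
    [v]; the bound [v <= tau] keeps the change of the test sets within the current tolerance. *)
Definition has_small_boxes (R : realType) (X : Type) (mu : set X -> \bar R)
    (U : set X) : Prop :=
  forall tau : R, 0 < tau -> exists (V : R -> set X) (v : R),
    [/\ 0 < v <= tau, V 1 `<=` U &
      forall s : R, 0 <= s <= 1 -> [/\ caratheodory_measurable mu (V s),
        V s `<=` V 1 & mu (V s) = (s * v)%:E]].

(* The test sets are limits of sequences [T n]; step [n] modifies them only on
   a piece [W n] of one of the countably many [U j], so that all pairs of one
   of the countably many [G i] separated by [U j] get distinguished by a
   definite amount, which the later, much smaller, steps cannot destroy. *)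
Lemma reconstructible_of_cover (R : realType) (X : Type)
    (mu : {outer_measure set X -> \bar R}) (F : set (set X)) (k m : nat)
    (G : nat -> set (set X)) (U : nat -> set X) :
  (2 * k < m)%N ->
  (forall A B, F A -> F B -> exists n, G n A /\ G n B) ->
  (forall n, covered_with_exponent mu k (G n)) ->
  (forall A B, F A -> F B -> A <> B ->
     exists j, U j `<=` A `\` B \/ U j `<=` B `\` A) ->
  (forall j, has_small_boxes mu (U j)) ->
  reconstructible mu F m.
Proof.
move=> km FG covG sepU smallU.
(* Stage [n] serves the pair (subfamily, box) coded by [n]; numbers that code nothing fall back on
   (0, 0), which does no harm. One visit per pair suffices, as later stages cannot undo it. *)
pose code n := odflt (0%N, 0%N) (unpickle n : option (nat * nat)).
pose state := ('I_m -> set X) * R : Type.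
pose ok (s : state) := [/\ forall i, caratheodory_measurable mu (s.1 i),
  forall i, (mu (s.1 i) < +oo)%E & 0 < s.2].
pose next (ns : nat * state) (r : state * set X) :=
  [/\ ok r.1, 0 <= r.1.2 <= ns.2.2 / 2, (mu r.2 <= (ns.2.2)%:E)%E,
      (forall i, ns.2.1 i `+` r.1.1 i `<=` r.2) &
      forall A B, G (code ns.1).1 A -> G (code ns.1).1 B ->
        U (code ns.1).2 `<=` A `\` B -> exists i,
        4 * r.1.2 < `|overlap mu A (r.1.1 i) - overlap mu B (r.1.1 i)|].
(* Each stage depends on the previous one, so one choice function on all (stage, state) is taken
   first and then iterated; its values on states violating [ok] are arbitrary. *)
have [f hf] : {f : nat * state -> state * set X &
    forall ns, ok ns.2 -> next ns (f ns)}.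
  apply: (@choice _ _ (fun ns r => ok ns.2 -> next ns r)) => -[n [T tau]].
  have [[/= cT mT tau0]|nok] := pselect (ok (T, tau)); last first.
    by exists (T, tau, set0) => /nok.
  have [V [v [/andP[v0 vtau] VU hV]]] := smallU (code n).2 _ tau0.
  have [T' [tau' [cT' mT' TT' /andP[tau'0 tau'h] sep]]] :=
    perturb_test_sets km (covG (code n).1) v0 tau0 hV cT mT.
  exists (T', tau', V 1) => _; split => //=.
  - by rewrite (ltW tau'0).
  - have [|_ _ ->] := hV 1%R; first by rewrite ler01 lexx.
    by rewrite mul1r lee_fin.
  - by move=> A B GA GB UAB; apply: sep => //; exact: subset_trans UAB.
pose st := fix st n : state :=
  if n is p.+1 then (f (p, st p)).1 else (fun=> set0, 1).
have okst n : ok (st n).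
  elim: n => [|n IH]; last by have [] := hf (n, st n) IH.
  split => //= i; first exact: caratheodory_measurable_set0.
  by rewrite outer_measure0 ltry.
pose W n := (f (n, st n)).2.
have nx n : next (n, st n) (st n.+1, W n).
  by have := hf (n, st n) (okst n); rewrite /= -surjective_pairing.
pose T n i := (st n).1 i; pose tau n := (st n).2.
(* The lower limit. A point outside all pieces used from stage [n] on keeps its membership from then
   on, so [Too i] agrees with [T n i] there. *)
pose Too i := \bigcup_n \bigcap_l T (n + l)%N i.
have cT n i : caratheodory_measurable mu (T n i) by have [h _ _] := okst n; exact: h.
have near n i : T n i `+` Too i `<=` \bigcup_l W (n + l)%N.
  move=> x h; apply: contrapT => nW.
  have E l : T (n + l)%N i x <-> T n i x.
    elim: l => [|l <-]; first by rewrite addn0.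
    have [_ _ _ /(_ i) /= TW _] := nx (n + l)%N.
    have nWl : ~ W (n + l)%N x by move=> w; apply: nW; exists l.
    rewrite addnS; split=> h'; apply: contrapT => h''; apply: nWl; apply: TW.
      by right.
    by left.
  case: h => [[Tx]|[[p _ px] nTx]].
    by apply; exists n => // l _; apply/E.
  apply: nTx; apply/(E p); rewrite addnC; exact: px.
have tailW n : (mu (\bigcup_l W (n + l)%N) <= (2 * tau n)%:E)%E.
  apply: outer_tail_le => l; first by have [_ + _ _ _] := nx l.
  by have [_ _ + _ _] := nx l.
have mToo i : (mu (Too i) < +oo)%E.
  apply: le_lt_trans (ltry (2 * tau 0%N)); apply: le_trans (tailW 0%N).
  by apply: le_outer_measure => x Tx; apply: (near 0%N i); right; split.
have close A n i : `|overlap mu A (T n i) - overlap mu A (Too i)| <= 2 * tau n.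
  apply: overlap_distr => //; [by have [_ h _] := okst n; exact: h|].
  by apply: le_trans (tailW n); apply: le_outer_measure; exact: near.
exists Too; split=> [i|A B FA FB eqAB].
  apply: caratheodory_measurable_bigcup => n.
  rewrite -[X in _ X]setCK setC_bigcap.
  apply/caratheodory_measurable_setC/caratheodory_measurable_bigcup => l.
  exact: caratheodory_measurable_setC.
have sep A' B' j n : G n A' -> G n B' ->
    (forall i, mu (A' `&` Too i) = mu (B' `&` Too i)) ->
    ~ U j `<=` A' `\` B'.
  (* After this stage the overlaps differ by more than [4 * tau N.+1], whereas equality in the limit
     allows at most twice [2 * tau N.+1]. *)
  move=> GA GB eqT UAB; pose N := pickle (n, j).
  have [_ _ _ _ /(_ A' B')] := nx N; rewrite /= /code pickleK /=.
  move=> /(_ GA GB UAB)[i].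
  have := close A' N.+1 i; have := close B' N.+1 i.
  rewrite /overlap -(eqT i) -/(T N.+1 i) -/(tau N.+1).
  rewrite !ler_norml ltNge => /andP[? ?] /andP[? ?] /negP; apply.
  by rewrite ler_norml; apply/andP; split; lra.
apply: contrapT => AB; have [n [GA GB]] := FG _ _ FA FB.
by have [j [|]] := sepU _ _ FA FB AB; apply: sep; eauto.
Qed.

(** * Lebesgue outer measure *)

Lemma box_volume_ge0 (R : realType) (d : nat) (a b : 'rV[R]_d) :
  0 <= box_volume a b.
Proof. by apply: prodr_ge0 => i _; rewrite le_max lexx orbT. Qed.

Lemma lebesgue_rV_le_cover (R : realType) (d : nat) (A : set 'rV[R]_d)
    (a b : nat -> 'rV[R]_d) : A `<=` \bigcup_k hobox (a k) (b k) ->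
  (lebesgue_measure_rV A <= \sum_(0 <= k <oo) (box_volume (a k) (b k))%:E)%E.
Proof. by move=> h; apply: ereal_inf_lbound; exists a, b. Qed.

Lemma lebesgue_rV_ge0 (R : realType) (d : nat) (A : set 'rV[R]_d) :
  (0 <= lebesgue_measure_rV A)%E.
Proof.
apply: le_ereal_inf_tmp => _ [a [b [_ ->]]]; apply: nneseries_ge0 => k _ _.
by rewrite lee_fin box_volume_ge0.
Qed.

Lemma le_lebesgue_rV (R : realType) (d : nat) :
  {homo @lebesgue_measure_rV R d : A B / A `<=` B >-> (A <= B)%E}.
Proof.
move=> A B AB; apply: ereal_inf_le_tmp => _ [a [b [Bab ->]]].
by exists a, b; split => //; exact: subset_trans Bab.
Qed.

Lemma box_volume_empty (R : realType) (d : nat) (a b : 'rV[R]_d) (i : 'I_d) :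
  b 0 i <= a 0 i -> box_volume a b = 0.
Proof.
by move=> ba; apply/eqP/prodf_eq0; exists i => //; apply/eqP/max_r; rewrite subr_le0.
Qed.

(** In dimension 0 every box has volume 1, an empty product, and covers are infinite sequences, so
    even the empty set would get infinite measure; hence [d.+1] here and below. *)
Lemma lebesgue_rV_set0 (R : realType) (d : nat) :
  @lebesgue_measure_rV R d.+1 set0 = 0%E.
Proof.
apply/eqP; rewrite eq_le lebesgue_rV_ge0 andbT.
apply: le_trans (lebesgue_rV_le_cover (a := fun=> 0) (b := fun=> 0) _) _ => //.
rewrite eseries0// => k _ _; rewrite (box_volume_empty (i := ord0))//.
Qed.

Lemma lebesgue_rV_sigma_subadditive (R : realType) (d : nat) :
  sigma_subadditive (@lebesgue_measure_rV R d).
Proof.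
move=> A; set mu := @lebesgue_measure_rV R d.
have [[i ioo]|] := pselect (exists i, mu (A i) = +oo%E).
  by rewrite (eseries_pinfty _ _ ioo) ?leey// => n _;
    rewrite gt_eqF// (lt_le_trans _ (lebesgue_rV_ge0 _))// ltNy0.
move=> /forallNP Aoo; apply/lee_addgt0Pr => e e0.
apply: le_trans (epsilon_trick _ (fun n => lebesgue_rV_ge0 (A n)) (ltW e0)).
have /choice[c hc] : forall n, exists ab : (nat -> 'rV[R]_d) * (nat -> 'rV[R]_d),
    A n `<=` \bigcup_k hobox (ab.1 k) (ab.2 k) /\
    (\sum_(0 <= k <oo) (box_volume (ab.1 k) (ab.2 k))%:E
       <= mu (A n) + (e / (2 ^ n.+1)%:R)%:E)%E.
  move=> n; have fin : mu (A n) \is a fin_num.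
    by rewrite ge0_fin_numE ?lebesgue_rV_ge0// ltey; apply/eqP/Aoo.
  have en : 0 < e / (2 ^ n.+1)%:R by rewrite divr_gt0// ltr0n expn_gt0.
  have [_ [a [b [Aab ->]]] /ltW h] := lb_ereal_inf_adherent en fin.
  by exists (a, b).
(* The chosen covers of all the [A n] are merged into one sequence along a bijection from nat to nat
   * nat. *)
have /card_esym/ppcard_eqP[f] := card_nat2.
pose g (p : nat * nat) := (box_volume ((c p.1).1 p.2) ((c p.1).2 p.2))%:E : \bar R.
have g0 p : (0 <= g p)%E by rewrite lee_fin box_volume_ge0.
apply: le_trans (lebesgue_rV_le_cover
    (a := fun k => (c (f k).1).1 (f k).2) (b := fun k => (c (f k).1).2 (f k).2) _) _.
  move=> x [n _ Anx]; have [k _ xk] := (hc n).1 _ Anx.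
  exists (f^-1%FUN (n, k)) => //=; by rewrite invK ?inE.
have -> : (\sum_(0 <= k <oo) (box_volume ((c (f k).1).1 (f k).2)
    ((c (f k).1).2 (f k).2))%:E = \sum_(0 <= i <oo) \sum_(0 <= j <oo) g (i, j))%E.
  rewrite (nneseries_esumT (fun k => g0 (f k))).
  rewrite -(reindex_esum [set: nat] [set: nat * nat] f g); last exact: bij.
  rewrite nneseries_esumT; last by move=> n; apply: nneseries_ge0.
  rewrite (eq_esum (b := fun i => \esum_(j in [set: nat]) g (i, j))); last first.
    by move=> i _; rewrite nneseries_esumT.
  rewrite (esum_esum (J := fun=> setT))//=.
  congr esum; apply/seteqP; split => // -[].
apply: lee_nneseries => [n _ _|n _]; first exact: nneseries_ge0.
exact: (hc n).2.
Qed.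

HB.instance Definition _ (R : realType) (d : nat) :=
  isOuterMeasure.Build R 'rV[R]_d.+1 (@lebesgue_measure_rV R d.+1)
    (lebesgue_rV_set0 R d) (@lebesgue_rV_ge0 R d.+1) (@le_lebesgue_rV R d.+1)
    (@lebesgue_rV_sigma_subadditive R d.+1).

(** * Boxes: measurability and volume *)

Definition row_upd (R : realType) (d : nat) (x : 'rV[R]_d) (i : 'I_d) (c : R) :
  'rV[R]_d := \row_j if j == i then c else x 0 j.

Lemma box_volume_cut (R : realType) (d : nat) (a b : 'rV[R]_d) (i : 'I_d) (c : R) :
  box_volume a (row_upd b i (Num.min (b 0 i) c)) +
  box_volume (row_upd a i (Num.max (a 0 i) c)) b = box_volume a b.
Proof.
rewrite /box_volume !(bigD1 (P := xpredT) i)//= !mxE eqxx.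
under eq_bigr => j /negPf ji do rewrite mxE ji.
under [X in _ + _ * X]eq_bigr => j /negPf ji do rewrite mxE ji.
rewrite -mulrDl; congr (_ * _); rewrite /Num.max /Num.min.
by do ![case: ifPn; rewrite -?leNgt]; lra.
Qed.

(** Cutting every box of a cover of [X] along the hyperplane gives covers of the two parts of [X]
    with the same total volume, by [box_volume_cut]; a piece that becomes empty has volume 0. *)
Lemma halfspace_caratheodory (R : realType) (d : nat) (i : 'I_d.+1) (c : R) :
  caratheodory_measurable (@lebesgue_measure_rV R d.+1) [set x | x 0 i <= c].
Proof.
apply: le_caratheodory_measurable => X; apply: le_ereal_inf_tmp.
move=> _ [a [b [Xab ->]]].
under eq_eseriesr => k _ do rewrite -(box_volume_cut _ _ i c) EFinD.
rewrite nneseriesD; try by move=> *; rewrite lee_fin box_volume_ge0.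
apply: leeD; apply: lebesgue_rV_le_cover => x [/Xab[k _ xk] xc]; exists k => // j;
  rewrite !mxE; have /andP[h1 h2] := xk j; case: eqP => [ji|]; rewrite ?h1 ?h2//.
- by subst j; rewrite le_min h2.
- by subst j; rewrite gt_max h1 andbT ltNge; apply/negP.
Qed.

Lemma hobox_caratheodory (R : realType) (d : nat) (a b : 'rV[R]_d.+1) :
  caratheodory_measurable (@lebesgue_measure_rV R d.+1) (hobox a b).
Proof.
(* A box is a finite intersection of slabs; their complements are indexed by nat, padded with
   [set0], to fit closure under countable unions. *)
pose H (i : 'I_d.+1) c := [set x : 'rV[R]_d.+1 | x 0 i <= c].
pose S (n : nat) : set 'rV[R]_d.+1 := if insub n is Some i then
  ~` (H i (b 0 i) `\` H i (a 0 i)) else set0.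
have -> : hobox a b = ~` \bigcup_n S n.
  apply/seteqP; split=> [x xab [n _]|x nx i].
    rewrite /S; case: insubP => // i _ _; apply; have /andP[h1 h2] := xab i.
    by split=> //; rewrite /H /= leNgt h1.
  apply: contrapT => h; apply: nx; exists (val i) => //.
  rewrite /S valK => -[h1 h2]; apply: h; apply/andP; split=> //.
  by rewrite ltNge; apply/negP.
apply: caratheodory_measurable_setC; apply: caratheodory_measurable_bigcup => n.
rewrite /S; case: insub => [i|]; last exact: caratheodory_measurable_set0.
by apply: caratheodory_measurable_setC; apply: caratheodory_measurable_setD;
  exact: halfspace_caratheodory.
Qed.

Lemma box_volume_recl (R : realType) (d : nat) (a b : 'rV[R]_d.+1) :
  box_volume a b = Num.max (b 0 0 - a 0 0) 0 *
    box_volume (\row_i a 0 (lift ord0 i)) (\row_i b 0 (lift ord0 i)).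
Proof.
rewrite /box_volume big_ord_recl; congr (_ * _).
by apply: eq_bigr => i _; rewrite !mxE.
Qed.

(* Induction on the dimension: slice along the first coordinate, and integrate
   the inequality between the slices. *)
Lemma box_volume_le_cover (R : realType) (d : nat) (P : nat -> bool)
    (a b : 'rV[R]_d) (c e : nat -> 'rV[R]_d) :
  (forall i, a 0 i < b 0 i) ->
  hobox a b `<=` \bigcup_(k in [set k | P k]) hobox (c k) (e k) ->
  ((box_volume a b)%:E <=
     \sum_(0 <= k <oo) ((P k)%:R * box_volume (c k) (e k))%:E)%E.
Proof.
have ge0 (n : nat) (Q : nat -> bool) (u v : nat -> 'rV[R]_n) k :
    (0 <= ((Q k)%:R * box_volume (u k) (v k))%:E)%E.
  by rewrite lee_fin mulr_ge0// box_volume_ge0.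
elim: d P a b c e => [|d IH] P a b c e ab cov.
  (* In dimension 0 all volumes are 1, so a single selected box is enough. *)
  have [k /= Pk _] : (\bigcup_(k in [set k | P k]) hobox (c k) (e k)) b.
    by apply: cov => -[].
  rewrite (@nneseriesD1 _ _ k)//.
  rewrite Pk /box_volume !big_ord0 mul1r leeDl//.
  by apply: nneseries_ge0 => n _ _; exact: ge0.
pose tl (x : 'rV[R]_d.+1) : 'rV[R]_d := \row_i x 0 (lift ord0 i).
pose I k := `](c k) 0 0, (e k) 0 0]%classic : set R.
pose w k := (P k)%:R * box_volume (tl (c k)) (tl (e k)).
have w0 k : 0 <= w k by rewrite mulr_ge0// box_volume_ge0.
pose D := `](a 0 0), (b 0 0)]%classic : set R.
have mD : measurable D by exact: measurable_itv.
have mI k : measurable (I k) by exact: measurable_itv.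
have mI1 k : measurable_fun D (fun t : R => (\1_(I k) t : R)%:E).
  by apply/measurable_EFinP/measurable_indic.
have mw k : measurable_fun D (fun t : R => (w k)%:E * (\1_(I k) t)%:E)%E.
  apply: measurable_funeM; exact: mI1.
(* Over [t] only the boxes whose first side contains [t] count. The selector [P] exists to absorb
   this condition, so that the induction hypothesis applies to the remaining coordinates. *)
have slice t : D t -> ((box_volume (tl a) (tl b))%:E <=
    \sum_(0 <= k <oo) ((w k)%:E * (\1_(I k) t)%:E))%E.
  rewrite /D /= in_itv /= => Dt.
  have -> : (\sum_(0 <= k <oo) ((w k)%:E * (\1_(I k) t)%:E) =
     \sum_(0 <= k <oo) ((P k && (t \in I k))%:R *
       box_volume (tl (c k)) (tl (e k)))%:E)%E.
    apply: eq_eseriesr => k _; rewrite -EFinM indicE /w; congr (_%:E).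
    by case: (P k); case: (t \in I k); rewrite /= ?mulr1 ?mulr0 ?mul0r ?mul1r.
  apply: IH => [i|y yab]; first by rewrite !mxE.
  pose x : 'rV[R]_d.+1 := \row_i if unlift ord0 i is Some j then y 0 j else t.
  have [|k /= Pk xk] := cov x.
    move=> i; rewrite mxE; case: unliftP => [j|] -> //.
    by have := yab j; rewrite !mxE.
  exists k => /=.
    rewrite Pk /=; apply/mem_set; rewrite /I /= in_itv /=.
    by have := xk ord0; rewrite mxE unlift_none.
  by move=> i; have := xk (lift ord0 i); rewrite !mxE liftK.
have int : (\int[lebesgue_measure]_(t in D) (box_volume (tl a) (tl b))%:E <=
    \int[lebesgue_measure]_(t in D)
      \sum_(0 <= k <oo) ((w k)%:E * (\1_(I k) t)%:E))%E.
  apply: ge0_le_integral => //.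
  - by move=> t _; rewrite lee_fin box_volume_ge0.
  - apply: (@ge0_emeasurable_sum _ _ _ D
      (fun k t => ((w k)%:E * (\1_(I k) t)%:E)%E) xpredT _ (fun k _ => mw k)).
    by move=> k t _ _; rewrite mule_ge0 ?lee_fin.
rewrite box_volume_recl.
have lenI (u v : R) : lebesgue_measure (`]u, v]%classic : set R) =
    (Num.max (v - u) 0)%:E.
  rewrite lebesgue_measure_itv /= lte_fin; case: ltP => uv.
    by rewrite max_l ?subr_ge0 ?ltW// EFinB.
  by rewrite max_r// subr_le0.
move: int; rewrite integral_cst// integral_nneseries//; first last.
- by move=> k t _; rewrite mule_ge0 ?lee_fin.
rewrite [X in (_ * X <= _)%E](lenI (a 0 0) (b 0 0)) mulrC EFinM => /le_trans; apply.
apply: lee_nneseries => k _.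
  move=> _; apply: integral_ge0 => t _; by rewrite mule_ge0 ?lee_fin.
rewrite ge0_integralZl ?lee_fin//; last exact: mI1.
rewrite integral_indic//; last exact: mI.
rewrite box_volume_recl mulrCA [X in (_ <= X%:E)%E]mulrC -/(w k) [X in (_ <= X)%E]EFinM.
apply: lee_wpmul2l; first by rewrite lee_fin.
apply: le_trans (_ : lebesgue_measure (I k) <= _)%E; last by rewrite lenI.
by apply: le_measure; rewrite ?inE//; [exact: measurableI (mI k) mD|exact: mI].
Qed.

Lemma lebesgue_rV_hobox (R : realType) (d : nat) (a b : 'rV[R]_d.+1) :
  lebesgue_measure_rV (hobox a b) = (box_volume a b)%:E.
Proof.
have [[i ba]|/forallNP ab] := pselect (exists i, b 0 i <= a 0 i).
  rewrite (box_volume_empty ba) (_ : hobox a b = set0) ?lebesgue_rV_set0//.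
  apply/seteqP; split=> // x /(_ i)/andP[h1 h2].
  by have := lt_le_trans h1 (le_trans h2 ba); rewrite ltxx.
apply/eqP; rewrite eq_le; apply/andP; split; last first.
  apply: le_ereal_inf_tmp => _ [c [e [cov ->]]].
  have := @box_volume_le_cover R _ xpredT a b c e.
  under eq_eseriesr do rewrite mul1r.
  apply => [i|x /cov[k _ xk]]; last by exists k.
  by rewrite ltNge; apply/negP/ab.
pose c k : 'rV[R]_d.+1 := if k is 0%N then b else a.
apply: le_trans (lebesgue_rV_le_cover (a := fun=> a) (b := c) _) _.
  by move=> x xab; exists 0%N.
rewrite nneseries_recl//=; last by move=> k _; rewrite lee_fin box_volume_ge0.
rewrite eseries_cond eseries0 ?adde0// => -[//|k] _ _ /=.
by rewrite (box_volume_empty (i := ord0)).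
Qed.

(** Only the first side is shortened, so the volume is linear in [s]; cutting that side down to at
    most [tau / p], with [p] the product of the other sides, keeps the volume within [tau]. *)
Lemma hobox_has_small_boxes (R : realType) (d : nat) (a b : 'rV[R]_d.+1) :
  (forall i, a 0 i < b 0 i) ->
  has_small_boxes (@lebesgue_measure_rV R d.+1) (hobox a b).
Proof.
move=> ab tau tau0.
set p := \prod_(i < d.+1 | i != ord0) (b 0 i - a 0 i).
have p0 : 0 < p by apply: prodr_gt0 => i _; rewrite subr_gt0.
pose w := Num.min (b 0 0 - a 0 0) (tau / p).
have w0 : 0 < w by rewrite lt_min subr_gt0 ab divr_gt0.
have wb : a 0 0 + w <= b 0 0 by rewrite -lerBrDl ge_min lexx.
have wtau : w * p <= tau by rewrite -ler_pdivlMr// ge_min lexx orbT.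
exists (fun s => hobox a (row_upd b 0 (a 0 0 + s * w))), (w * p); split.
- by rewrite mulr_gt0.
- move=> x xV i; have := xV i; rewrite mxE; case: eqP => // ->.
  by move=> /andP[-> /= h]; rewrite (le_trans h)// mul1r.
- move=> s /andP[s0 s1]; split; first exact: hobox_caratheodory.
    move=> x xV i; have := xV i; rewrite !mxE; case: eqP => // ->.
    by move=> /andP[-> /= h]; rewrite (le_trans h)// lerD2l ler_pM2r.
  rewrite lebesgue_rV_hobox; congr (_%:E).
  rewrite /box_volume (bigD1 ord0)//= !mxE eqxx addrC addKr.
  rewrite max_l; last exact: mulr_ge0 s0 (ltW w0).
  rewrite -mulrA; congr (_ * (_ * _)).
  apply: eq_bigr => i /negPf i0; rewrite !mxE i0 max_l// subr_ge0 ltW//.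
Qed.

Lemma open_rat_hobox (R : realType) (d : nat) (O : set 'rV[R]_d.+1)
    (x : 'rV[R]_d.+1) : open O -> O x ->
  exists p q : 'rV[rat]_d.+1, [/\ forall i, p 0 i < q 0 i,
    hobox (map_mx ratr p) (map_mx ratr q) x &
    hobox (map_mx ratr p) (map_mx ratr q) `<=` O].
Proof.
move=> oO Ox; have /nbhs_ballP[e /= e0 eO] : nbhs x O by exact: open_nbhs_nbhs.
have rat_between (u v : R) : exists r : rat, u < v -> u < ratr r < v.
  have [uv|] := ltP u v; last by exists 0.
  have [r] := rat_in_itvoo uv; rewrite in_itv /= => h; by exists r.
have /choice[p hp] i := rat_between (x 0 i - e / 2) (x 0 i).
have /choice[q hq] i := rat_between (x 0 i) (x 0 i + e / 2).
have {}hp i : x 0 i - e / 2 < ratr (p i) < x 0 i by apply: hp; lra.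
have {}hq i : x 0 i < ratr (q i) < x 0 i + e / 2 by apply: hq; lra.
exists (\row_i p i), (\row_i q i); split.
- move=> i; rewrite !mxE -(ltr_rat R).
  by have := hp i; have := hq i => /andP[? ?] /andP[? ?]; lra.
- move=> i; rewrite !mxE.
  by have := hp i; have := hq i => /andP[? ?] /andP[? ?]; apply/andP; split; lra.
- move=> y hy; apply: eO; split=> [//|i j]; rewrite (ord1 i) /ball /= .
  have := hy j; have := hp j; have := hq j; rewrite !mxE.
  by move=> /andP[? ?] /andP[? ?] /andP[? ?]; rewrite ltr_norml; apply/andP; split; lra.
Qed.

(** The unit box is the default, so that every index yields a nondegenerate box, inside which test
    sets can be modified. *)
Definition rat_hobox (R : realType) (d : nat) (n : nat) : set 'rV[R]_d :=
  let: (p, q) := odflt (0, const_mx 1)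
    (unpickle n : option ('rV[rat]_d * 'rV[rat]_d)) in
  if [forall i, p 0 i < q 0 i] then hobox (map_mx ratr p) (map_mx ratr q)
  else hobox 0 (const_mx 1).

Lemma rat_hobox_is_box (R : realType) (d n : nat) :
  exists a b : 'rV[R]_d, rat_hobox n = hobox a b /\ forall i, a 0 i < b 0 i.
Proof.
rewrite /rat_hobox; case: (odflt _ _) => p q; case: ifPn => [/forallP pq|_].
  by exists (map_mx ratr p), (map_mx ratr q); split=> // i; rewrite !mxE ltr_rat.
by exists 0, (const_mx 1); split=> // i; rewrite !mxE.
Qed.

Lemma open_rat_hobox_basis (R : realType) (d : nat) (O : set 'rV[R]_d.+1)
    (x : 'rV[R]_d.+1) : open O -> O x ->
  exists n, rat_hobox n x /\ rat_hobox n `<=` O.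
Proof.
move=> oO Ox; have [p [q [pq xpq pqO]]] := open_rat_hobox oO Ox.
exists (pickle (p, q)); rewrite /rat_hobox pickleK /=.
by have -> : [forall i, p 0 i < q 0 i] by exact/forallP.
Qed.

Lemma open_caratheodory (R : realType) (d : nat) (O : set 'rV[R]_d.+1) :
  open O -> caratheodory_measurable (@lebesgue_measure_rV R d.+1) O.
Proof.
move=> oO.
have -> : O = \bigcup_n if `[< rat_hobox n `<=` O >] then rat_hobox n else set0.
  apply/seteqP; split=> [x Ox|x [n _]].
    have [n [xn nO]] := open_rat_hobox_basis oO Ox.
    by exists n => //; rewrite asboolT.
  by case: asboolP => // h; exact: h.
apply: caratheodory_measurable_bigcup => n.
case: asboolP => _; last exact: caratheodory_measurable_set0.
have [a [b [-> _]]] := @rat_hobox_is_box R d.+1 n; exact: hobox_caratheodory.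
Qed.

Lemma closed_caratheodory (R : realType) (d : nat) (C : set 'rV[R]_d.+1) :
  closed C -> caratheodory_measurable (@lebesgue_measure_rV R d.+1) C.
Proof.
move=> cC; rewrite -[C]setCK; apply: caratheodory_measurable_setC.
exact: open_caratheodory (closed_openC cC).
Qed.

Definition cube (R : realType) (d : nat) (M : R) : set 'rV[R]_d :=
  [set x | forall i, `|x 0 i| <= M].

Lemma lebesgue_rV_cube (R : realType) (d : nat) (M : R) : 0 <= M ->
  (lebesgue_measure_rV (@cube R d.+1 M) <= ((2 * M + 1) ^+ d.+1)%:E)%E.
Proof.
move=> M0; apply: le_trans (le_lebesgue_rV (y :=
  hobox (const_mx (- M - 1)) (const_mx M)) _) _.
  move=> x xM i; have := xM i; rewrite !mxE ler_norml => /andP[? ?].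
  by apply/andP; split; lra.
rewrite lebesgue_rV_hobox lee_fin /box_volume.
under eq_bigr do rewrite !mxE.
rewrite prodr_const card_ord lerXn2r ?nnegrE//; [|lra|].
  by rewrite le_max lexx orbT.
by rewrite ge_max; apply/andP; split; lra.
Qed.

Definition dilation (R : realType) (d : nat) (z : 'rV[R]_d) (s : R)
  (x : 'rV[R]_d) : 'rV[R]_d := z + s *: (x - z).

Lemma lebesgue_rV_dilation_le (R : realType) (d : nat) (z : 'rV[R]_d.+1) (s : R)
    (A B : set 'rV[R]_d.+1) : 0 < s ->
  (forall x, B x -> A (dilation z s^-1 x)) ->
  (lebesgue_measure_rV B <= (s ^+ d.+1)%:E * lebesgue_measure_rV A)%E.
Proof.
move=> s0 BA; have sd0 : 0 < s ^+ d.+1 by rewrite exprn_gt0.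
rewrite -lee_pdivrMl//; apply: le_ereal_inf_tmp => _ [a [b [cov ->]]].
rewrite lee_pdivrMl//.
have -> : ((s ^+ d.+1)%:E * \sum_(0 <= k <oo) (box_volume (a k) (b k))%:E =
    \sum_(0 <= k <oo) (box_volume (dilation z s (a k)) (dilation z s (b k)))%:E)%E.
  rewrite -nneseriesZl; last by move=> k _; rewrite lee_fin box_volume_ge0.
  apply: eq_eseriesr => k _; rewrite -EFinM; congr (_%:E).
  rewrite /box_volume -[X in s ^+ X]card_ord -prodr_const -big_split /=.
  apply: eq_bigr => i _; rewrite !mxE maxr_pMr ?ltW// mulr0; congr Num.max.
  ring.
apply: lebesgue_rV_le_cover => x /BA/cov[k _ xk]; exists k => // i.
have := xk i; rewrite !mxE => /andP[h1 h2].
have -> : x 0 i = z 0 i + s * (z 0 i + s^-1 * (x 0 i - z 0 i) - z 0 i).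
  by field; rewrite gt_eqF.
by rewrite ltrD2l lerD2l ltr_pM2l// ler_pM2l// ltrD2r lerD2r h1.
Qed.

(** * Thin shells and bodies given by homogeneous functions *)

Lemma expr_sub_le (R : realFieldType) (x y : R) (n : nat) :
  0 <= y -> y <= x -> x <= 2 -> x ^+ n - y ^+ n <= n%:R * 2 ^+ n * (x - y).
Proof.
move=> y0 yx x2; elim: n => [|n IH]; first by rewrite !expr0 subrr mul0r mul0r.
have yn : y ^+ n <= 2 ^+ n by rewrite lerXn2r ?nnegrE//; lra.
have x0 : 0 <= x by lra.
have p0 : 0 <= 2 ^+ n * (x - y) by rewrite mulr_ge0 ?exprn_ge0// subr_ge0.
have -> : x ^+ n.+1 - y ^+ n.+1 = x * (x ^+ n - y ^+ n) + y ^+ n * (x - y).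
  by rewrite !exprS; ring.
have h1 : x * (x ^+ n - y ^+ n) <= 2 * (n%:R * 2 ^+ n * (x - y)).
  apply: le_trans (ler_wpM2l x0 IH) _; apply: ler_wpM2r => //.
  by rewrite -mulrA mulr_ge0.
have h2 : y ^+ n * (x - y) <= 2 ^+ n * (x - y) by rewrite ler_wpM2r// subr_ge0.
rewrite exprS -[n.+1]addn1 natrD.
move: h1 h2 p0; set u := x * _; set v := y ^+ n * _.
have -> : (n%:R + 1%:R) * (2 * 2 ^+ n) * (x - y) =
  2 * (n%:R * 2 ^+ n * (x - y)) + 2 * (2 ^+ n * (x - y)) by ring.
lra.
Qed.

Lemma sublevel_closed (R : realType) (d : nat) (J : Type)
    (f : J -> 'rV[R]_d -> R) (c : J -> R) :
  (forall j, continuous (f j)) -> closed [set x | forall j, f j x <= c j].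
Proof.
move=> cf; have -> : [set x | forall j, f j x <= c j] =
    \bigcap_j (f j @^-1` [set y | y <= c j]).
  by apply/seteqP; split=> [x h j _|x h j]; exact: h.
apply: closed_bigI => j _; apply: closed_comp => [x _|]; [exact: cf|exact: closed_le].
Qed.

(** Under this condition the set where [f j x <= s ^+ e j] for all [j] is the dilate by [s] about
    [z] of the body [f j x <= 1]. Degree 1 serves rectangles and simplices, degree 2 balls and
    ellipsoids. *)
Definition homogeneous_at (R : realType) (d : nat) (J : Type)
    (f : J -> 'rV[R]_d -> R) (e : J -> nat) (z : 'rV[R]_d) : Prop :=
  [/\ forall j, continuous (f j), forall j, (1 <= e j <= 2)%N &
      forall j s x, 0 < s -> f j (dilation z s x) = s ^+ e j * f j x].

(* The shell lies between the dilates of the body by [1 - 2 * t] and [1 + t]. *)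
Lemma small_shell_le (R : realType) (d : nat) (J : Type)
    (f : J -> 'rV[R]_d.+1 -> R) (e : J -> nat) (z : 'rV[R]_d.+1) (M t : R) :
  0 <= M -> homogeneous_at f e z ->
  [set x | forall j, f j x <= 1] `<=` cube M -> 0 < t <= 4^-1 ->
  (lebesgue_measure_rV
     [set x | ((forall j, f j x <= 1 + t) /\ exists j, 1 - t <= f j x)%R] <=
   (d.+1%:R * 2 ^+ d.+1 * (2 * M + 1) ^+ d.+1 * 3 * t)%:E)%E.
Proof.
move=> M0 [cf e12 hf] AM /andP[t0 t4].
set S := [set x | _].
pose A (s : R) := [set x | forall j, f j x <= s ^+ e j].
pose mu := @lebesgue_measure_rV R d.+1.
have mA (s r : R) : 0 < s -> 0 < r ->
    (mu (A s) <= ((s / r) ^+ d.+1)%:E * mu (A r))%E.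
  move=> s0 r0; apply: (@lebesgue_rV_dilation_le _ _ z) => [|x xA j].
    by rewrite divr_gt0.
  rewrite hf; last by rewrite invr_gt0 divr_gt0.
  have -> : r ^+ e j = (s / r)^-1 ^+ e j * s ^+ e j.
    by rewrite -exprMn invf_div divfK// gt_eqF.
  by rewrite ler_pM2l ?exprn_gt0 ?invr_gt0 ?divr_gt0//; exact: xA.
have mA1 : (mu (A 1%R) <= ((2 * M + 1) ^+ d.+1)%:E)%E.
  apply: le_trans (lebesgue_rV_cube d M0); apply: le_lebesgue_rV => x xA.
  by apply: AM => j; have := xA j; rewrite expr1n.
have fin1 : mu (A 1) \is a fin_num.
  by rewrite ge0_fin_numE ?lebesgue_rV_ge0// (le_lt_trans mA1)// ltry.
pose r := 1 - 2 * t; pose s := 1 + t.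
have r0 : 0 < r by rewrite /r; lra.
have s0 : 0 < s by rewrite /s; lra.
have fins u : 0 < u -> mu (A u) \is a fin_num.
  move=> u0; rewrite ge0_fin_numE ?lebesgue_rV_ge0//.
  apply: le_lt_trans (mA _ 1%R u0 ltr01) _.
  by rewrite -(fineK fin1) -EFinM ltry.
have rs : A r `<=` A s.
  move=> x xA j; apply: le_trans (xA j) _.
  by rewrite lerXn2r ?nnegrE ?ltW///r /s; lra.
(* For k = 1, 2 one has 1 + t <= (1 + t)^k and (1 - 2t)^k < 1 - t; the bound 1/4 on t keeps the
   inner factor positive. *)
have SA : S `<=` A s `\` A r.
  move=> x [h [j hj]]; have p2 (u : R) (k : nat) : (1 <= k <= 2)%N ->
      u ^+ k = u \/ u ^+ k = u * u.
    by case: k => [//|[|[|//]]] _; [left|right]; rewrite ?expr1 ?expr2.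
  split=> [i|/(_ j)].
    apply: le_trans (h i) _; rewrite -/s.
    by case: (p2 s (e i) (e12 i)) => ->; rewrite /s; nra.
  by case: (p2 r (e j) (e12 j)) => ->; rewrite /r => h'; nra.
(* The inner dilate is Caratheodory measurable because it is closed, so the measure of the
   difference is the difference of the measures. *)
have clr : closed (A r) by exact: sublevel_closed.
have := closed_caratheodory clr (A s).
rewrite (setIidr rs) -setDE -/mu => E.
apply: le_trans (le_lebesgue_rV SA) _.
have finD : mu (A s `\` A r) \is a fin_num.
  by rewrite (outer_fin (B := A s))// ?ltey_eq ?fins//; exact: subDsetl.
have h1 : fine (mu (A s)) <= s ^+ d.+1 * fine (mu (A 1)).
  rewrite -lee_fin EFinM !fineK ?fins//.
  by have := mA s 1%R s0 ltr01; rewrite divr1.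
have h2 : r ^+ d.+1 * fine (mu (A 1)) <= fine (mu (A r)).
  rewrite -ler_pdivlMl ?exprn_gt0// -lee_fin EFinM !fineK ?fins//.
  by have := mA 1%R r ltr01 r0; rewrite div1r exprVn.
move: E; rewrite -/mu -(fineK (fins _ s0)) -(fineK (fins _ r0)) -(fineK finD).
rewrite -EFinD => -[E]; rewrite lee_fin.
have E' : fine (mu (A s `\` A r)) <= (s ^+ d.+1 - r ^+ d.+1) * fine (mu (A 1)).
  by rewrite mulrBl; lra.
apply: le_trans E' _.
have f0 : 0 <= fine (mu (A 1)) by rewrite fine_ge0// lebesgue_rV_ge0.
apply: le_trans (ler_wpM2r f0 (expr_sub_le _ _ _ _)) _; rewrite /r /s; try lra.
have -> : 1 + t - (1 - 2 * t) = 3 * t by ring.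
rewrite -!mulrA ler_wpM2l// ler_wpM2l ?exprn_ge0//.
rewrite mulrA mulrC ler_wpM2r ?mulr_ge0 ?(ltW t0)//.
by rewrite -lee_fin fineK.
Qed.

(** The constant depends on [M] and the dimension alone, as a net for a whole subfamily requires.
    For [t] above 1/4 the measure of the cube is itself bounded by a multiple of [t], whence the
    intersection with [cube M]. *)
Lemma shell_le (R : realType) (d : nat) (M : R) : 0 <= M ->
  exists2 C : R, 0 <= C & forall (J : Type)
    (f : J -> 'rV[R]_d.+1 -> R) (e : J -> nat) (z : 'rV[R]_d.+1) (t : R),
  homogeneous_at f e z -> [set x | forall j, f j x <= 1] `<=` cube M -> 0 < t ->
  (lebesgue_measure_rV
     (cube M `&` [set x | ((forall j, f j x <= 1 + t) /\ exists j, 1 - t <= f j x)%R])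
   <= (C * t)%:E)%E.
Proof.
move=> M0; set B := (2 * M + 1) ^+ d.+1.
have B0 : 0 <= B by rewrite exprn_ge0//; lra.
set C1 := d.+1%:R * 2 ^+ d.+1 * B * 3.
have C10 : 0 <= C1 by rewrite !mulr_ge0.
exists (C1 + 4 * B) => [|J f e z t hf AM t0]; first by rewrite addr_ge0 ?mulr_ge0.
have [t4|t4] := leP t 4^-1.
  apply: le_trans (le_lebesgue_rV (@subIsetr _ _ _)) _.
  apply: le_trans (small_shell_le M0 hf AM _) _; first by rewrite t0.
  rewrite lee_fin ler_wpM2r ?(ltW t0)//.
  by rewrite lerDl mulr_ge0.
apply: le_trans (le_lebesgue_rV (@subIsetl _ _ _)) _.
apply: le_trans (lebesgue_rV_cube d M0) _; rewrite lee_fin -/B.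
have h : 0 <= C1 * t by rewrite mulr_ge0// ltW.
rewrite mulrDl; nra.
Qed.

Lemma grid_approx (R : realType) (n K : nat) (x : R) : (0 < K)%N ->
  `|x| <= n%:R -> exists i : 'I_(2 * n * K).+1, `|i%:R / K%:R - n%:R - x| <= K%:R^-1.
Proof.
move=> K0; rewrite ler_norml => /andP[x1 x2].
have KR : 0 < K%:R :> R by rewrite ltr0n.
set y := (x + n%:R) * K%:R.
have y0 : 0 <= y by rewrite mulr_ge0 ?(ltW KR)//; lra.
have [i1 i2] : (Num.truncn y)%:R <= y /\ y < (Num.truncn y).+1%:R.
  by have /andP[] := truncn_itv y0.
have i3 : (Num.truncn y < (2 * n * K).+1)%N.
  rewrite ltnS -(ler_nat R) (le_trans i1)// /y !natrM ler_wpM2r//.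
  lra.
exists (Ordinal i3) => /=.
have -> : (Num.truncn y)%:R / K%:R - n%:R - x = ((Num.truncn y)%:R - y) * K%:R^-1.
  by rewrite /y; field; rewrite gt_eqF.
rewrite normrM (@gtr0_norm _ K%:R^-1) ?invr_gt0// ler_piMl ?invr_ge0//.
rewrite ler_norml; move: i2; rewrite -addn1 natrD => i2; apply/andP; split; lra.
Qed.

(** A parameter grid of mesh 1/(l * K), with [l] above [L], gives an error of at most 1/K. The
    finite type [S] carries discrete data and only multiplies the size of the net by a constant, so
    the exponent is the number of real parameters. *)
Lemma covered_of_lipschitz (R : realType) (X : Type)
    (mu : {outer_measure set X -> \bar R}) (P S : finType) (G : set (set X))
    (D : S -> (P -> R) -> set X) (M L : R) :
  (forall A, G A -> exists (s : S) (theta : P -> R),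
    (forall p, `|theta p| <= M) /\
    forall eps theta', 0 < eps -> eps <= 1 ->
      (forall p, `|theta' p - theta p| <= eps) ->
      (mu (A `+` D s theta') <= (L * eps)%:E)%E) ->
  covered_with_exponent mu #|P| G.
Proof.
move=> h; set n := Num.bound M; set l := (Num.bound L).+1.
exists (#|S| * (2 * n * l).+1 ^ #|P|)%N => K K0.
pose I : finType := (S * {ffun P -> 'I_(2 * n * (l * K)).+1})%type.
have lK : (0 < l * K)%N by rewrite muln_gt0.
exists I, (fun i : I => D i.1 (fun p => (i.2 p)%:R / (l * K)%:R - n%:R)); split.
  rewrite card_prod card_ffun card_ord -[X in (_ <= X)%N]mulnA -expnMn leq_mul2l.
  apply/orP; right; case: #|P| => [|q]; first by rewrite !expn0.
  by rewrite leq_exp2r// mulSn mulnA -addn1 addnC leq_add2r.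
move=> A GA; have [s [theta [hM hA]]] := h A GA.
have /choice[g hg] p : exists i : 'I_(2 * n * (l * K)).+1,
    `|i%:R / (l * K)%:R - n%:R - theta p| <= (l * K)%:R^-1.
  apply: (grid_approx lK); apply: le_trans (hM p) _.
  by apply/ltW/(le_lt_trans (ler_norm M)); exact: unstable.ltr_norm_bound.
exists (s, [ffun p => g p]) => /=.
apply: le_trans (hA (l * K)%:R^-1 _ _ _ _) _.
- by rewrite invr_gt0 ltr0n.
- by rewrite invf_le1 ?ltr0n// ler1n.
- by move=> p; rewrite ffunE; exact: hg.
rewrite lee_fin natrM invfM mulrA ler_piMl ?invr_ge0//.
rewrite ler_pdivrMr ?ltr0n// mul1r.
apply/ltW/(le_lt_trans (ler_norm L))/(lt_trans (unstable.ltr_norm_bound L)).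
by rewrite ltr_nat.
Qed.

(** * Lipschitz dependence on parameters, and the resulting reconstruction criteria *)

(** The bound on [g] itself is carried along because the Lipschitz constant of a product involves
    it. *)
Definition param_lipschitz (R : realType) (d : nat) (P : Type)
    (g : (P -> R) -> 'rV[R]_d -> R) : Prop :=
  forall M : R, exists2 C : R, 0 <= C & forall theta theta' x eps,
    (forall p, `|theta p| <= M) -> (forall p, `|theta' p| <= M) ->
    (forall p, `|theta' p - theta p| <= eps) -> cube M x -> 0 <= eps ->
    `|g theta x| <= C /\ `|g theta' x - g theta x| <= C * eps.

Lemma param_lipschitz_param (R : realType) (d : nat) (P : Type) (p : P) :
  @param_lipschitz R d P (fun theta _ => theta p).
Proof.
move=> M; exists (`|M| + 1) => [|theta theta' x eps h1 h2 h3 hx e0].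
  by rewrite addr_ge0.
split; first by rewrite (le_trans (h1 p))// (le_trans (ler_norm _))// lerDl.
by apply: le_trans (h3 p) _; rewrite ler_peMl// lerDr.
Qed.

Lemma param_lipschitz_coord (R : realType) (d : nat) (P : Type) (i : 'I_d) :
  @param_lipschitz R d P (fun _ x => x 0 i).
Proof.
move=> M; exists `|M| => // theta theta' x eps h1 h2 h3 hx e0.
by rewrite subrr normr0 mulr_ge0// (le_trans (hx i))// ler_norm.
Qed.

Lemma param_lipschitz_cst (R : realType) (d : nat) (P : Type) (c : R) :
  @param_lipschitz R d P (fun _ _ => c).
Proof.
move=> M; exists `|c| => // theta theta' x eps h1 h2 h3 hx e0.
by rewrite subrr normr0 mulr_ge0.
Qed.

Lemma param_lipschitzD (R : realType) (d : nat) (P : Type)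
    (g h : (P -> R) -> 'rV[R]_d -> R) :
  param_lipschitz g -> param_lipschitz h ->
  param_lipschitz (fun theta x => g theta x + h theta x).
Proof.
move=> lg lh M; have [C C0 hC] := lg M; have [D D0 hD] := lh M.
exists (C + D) => [|theta theta' x eps h1 h2 h3 hx e0]; first exact: addr_ge0.
have [c1 c2] := hC _ _ _ _ h1 h2 h3 hx e0.
have [d1 d2] := hD _ _ _ _ h1 h2 h3 hx e0.
split; first by rewrite (le_trans (ler_normD _ _))// lerD.
rewrite opprD addrACA mulrDl (le_trans (ler_normD _ _))// lerD//.
Qed.

Lemma param_lipschitzM (R : realType) (d : nat) (P : Type)
    (g h : (P -> R) -> 'rV[R]_d -> R) :
  param_lipschitz g -> param_lipschitz h ->
  param_lipschitz (fun theta x => g theta x * h theta x).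
Proof.
move=> lg lh M; have [C C0 hC] := lg M; have [D D0 hD] := lh M.
exists (2 * C * D) => [|theta theta' x eps h1 h2 h3 hx e0]; first by rewrite !mulr_ge0.
have [c1 c2] := hC _ _ _ _ h1 h2 h3 hx e0.
have [d1 d2] := hD _ _ _ _ h1 h2 h3 hx e0.
have e1 p : `|theta p - theta' p| <= eps by rewrite distrC.
have [c3 _] := hC _ _ _ _ h2 h1 e1 hx e0.
split.
  rewrite normrM (le_trans (ler_pM _ _ c1 d1))//.
  by rewrite -mulrA ler_peMl ?mulr_ge0// ler1n.
have -> : g theta' x * h theta' x - g theta x * h theta x =
  g theta' x * (h theta' x - h theta x) + (g theta' x - g theta x) * h theta x.
  by ring.
rewrite (le_trans (ler_normD _ _))// !normrM.
have k1 := ler_pM (normr_ge0 _) (normr_ge0 _) c3 d2.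
have k2 := ler_pM (normr_ge0 _) (normr_ge0 _) c2 d1.
apply: le_trans (lerD k1 k2) _.
by rewrite le_eqVlt; apply/orP; left; apply/eqP; ring.
Qed.

Lemma param_lipschitzN (R : realType) (d : nat) (P : Type)
    (g : (P -> R) -> 'rV[R]_d -> R) :
  param_lipschitz g -> param_lipschitz (fun theta x => - g theta x).
Proof.
move=> lg M; have [C C0 hC] := lg M; exists C => // theta theta' x eps h1 h2 h3 hx e0.
by rewrite normrN -opprD normrN; exact: hC h3 hx e0.
Qed.

Lemma param_lipschitz_sum (R : realType) (d : nat) (P : Type) (I : Type)
    (s : seq I) (g : I -> (P -> R) -> 'rV[R]_d -> R) :
  (forall i, param_lipschitz (g i)) ->
  param_lipschitz (fun theta x => \sum_(i <- s) g i theta x).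
Proof.
move=> lg; elim: s => [|i s IH].
  by under eq_fun do under eq_fun do rewrite big_nil; exact: param_lipschitz_cst.
under eq_fun do under eq_fun do rewrite big_cons.
exact: param_lipschitzD.
Qed.

(** If [x] is in [A] but not in [B], the complement of [B] is an open neighbourhood of [x] and so
    meets the interior of [A]; a rational box fits into this open intersection. *)
Lemma reconstructible_regular (R : realType) (d k m : nat)
    (F : set (set 'rV[R]_d.+1)) (G : nat -> set (set 'rV[R]_d.+1)) :
  (2 * k < m)%N ->
  (forall A B, F A -> F B -> exists n, G n A /\ G n B) ->
  (forall n, covered_with_exponent (@lebesgue_measure_rV R d.+1) k (G n)) ->
  (forall A, F A -> closed A /\ A `<=` closure (interior A)) ->
  reconstructible (@lebesgue_measure_rV R d.+1) F m.
Proof.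
move=> km FG covG regF.
have sep A B x : F A -> F B -> A x -> ~ B x ->
    exists n, @rat_hobox R d.+1 n `<=` A `\` B.
  move=> FA FB Ax nBx; have [_ /(_ x Ax) clA] := regF A FA.
  have oB : open (~` B) by apply: closed_openC; have [] := regF B FB.
  have [y [Ay nBy]] := clA _ (open_nbhs_nbhs (conj oB nBx)).
  have oI : open (interior A `&` ~` B) by apply: openI => //; exact: open_interior.
  have [n [_ h]] := open_rat_hobox_basis oI (conj Ay nBy).
  by exists n => w /h[/interior_subset].
apply: (reconstructible_of_cover km FG covG (U := @rat_hobox R d.+1)).
  move=> A B FA FB AB; apply: contrapT => h; apply: AB; apply/seteqP.
  by split=> x; apply: contraPP => nx x';
    [have [n hn] := sep A B x FA FB x' nx|have [n hn] := sep B A x FB FA x' nx];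
    apply: h; exists n; [left|right].
move=> n; have [a [b [-> ab]]] := @rat_hobox_is_box R d.+1 n.
exact: hobox_has_small_boxes.
Qed.

Lemma homogeneous_body_regular (R : realType) (d : nat) (J : finType)
    (f : J -> 'rV[R]_d -> R) (e : J -> nat) (z : 'rV[R]_d) :
  homogeneous_at f e z ->
  closed [set x | forall j, f j x <= 1] /\
  [set x | forall j, f j x <= 1] `<=`
    closure (interior [set x | forall j, f j x <= 1]).
Proof.
move=> [cf e12 hf]; split; first exact: sublevel_closed.
set A := [set x | _]; move=> x xA O Ox.
have oA' : open [set y | forall j, f j y < 1].
  rewrite openE => y h.
  have hj j : \forall w \near y, f j w < 1 by exact: cvgr_lt (cf j y) _ (h j).
  exact: filter_forall hj.
have cvg_x : dilation z (1 - n.+1%:R^-1) x @[n --> \oo] --> x.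
  rewrite [X in _ --> X](_ : x = z + (1 - 0) *: (x - z)); last first.
    by rewrite subr0 scale1r addrC subrK.
  apply: cvgD; first exact: cvg_cst.
  apply: cvgZr_tmp; apply: cvgB; first exact: cvg_cst.
  exact: cvg_harmonic.
(* Contraction towards [z] turns f <= 1 into f < 1. Index n + 1 is used because its factor 1 - 1/(n
   + 2) is positive, while index 0 has factor 0. *)
have [n _ hn] := cvg_x _ Ox.
exists (dilation z (1 - n.+2%:R^-1) x); split; last exact: hn (leqnSn n).
have : [set y | forall j, f j y < 1] `<=` interior A.
  by rewrite -open_subsetE// => y h j; exact/ltW.
apply=> j; set s := 1 - _.
have s0 : 0 < s by rewrite subr_gt0 invf_lt1 ?ltr0n// ltr1n.
have s1 : s < 1 by rewrite ltrBlDr ltrDl invr_gt0 ltr0n.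
rewrite hf//; have [f0|f0] := leP (f j x) 0.
  apply: le_lt_trans ltr01; rewrite mulr_ge0_le0// exprn_ge0// ltW//.
apply: le_lt_trans (_ : s ^+ e j < _).
  by rewrite ler_piMr ?exprn_ge0 ?(ltW s0)//; exact: xA.
rewrite exprn_ilt1// ?ltW//.
by have /andP[] := e12 j; case: (e j).
Qed.

Lemma reconstructible_homogeneous (R : realType) (d m : nat) (P J : finType)
    (f : (P -> R) -> J -> 'rV[R]_d.+1 -> R) (F : set (set 'rV[R]_d.+1)) :
  (2 * #|P| < m)%N ->
  (forall j, param_lipschitz (fun theta => f theta j)) ->
  (forall A, F A -> exists theta e z M,
    [/\ A = [set x | forall j, f theta j x <= 1],
        homogeneous_at (f theta) e z & A `<=` cube M]) ->
  reconstructible (@lebesgue_measure_rV R d.+1) F m.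
Proof.
move=> Pm lf hF.
pose G (n : nat) : set (set 'rV[R]_d.+1) := [set A | exists theta e z,
  [/\ A = [set x | forall j, f theta j x <= 1],
      homogeneous_at (f theta) e z, A `<=` cube n%:R &
      forall p, `|theta p| <= n%:R]].
have GW n n' A : (n <= n')%N -> G n A -> G n' A.
  move=> nn' [theta [e [z [EA hA cA htheta]]]]; exists theta, e, z; split=> //.
    by move=> x /cA h i; apply: le_trans (h i) _; rewrite ler_nat.
  by move=> p; apply: le_trans (htheta p) _; rewrite ler_nat.
have FG A : F A -> exists n, G n A.
  move=> /hF[theta [e [z [M [EA hA cA]]]]].
  exists (Num.bound (M + \sum_p `|theta p|) + Num.bound M)%N.
  have le_bound (u : R) : u <= (Num.bound u)%:R.
    by apply/ltW/(le_lt_trans (ler_norm u)); exact: unstable.ltr_norm_bound.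
  exists theta, e, z; split=> //.
    move=> x /cA h i; apply: le_trans (h i) _; apply: le_trans (le_bound M) _.
    by rewrite ler_nat leq_addl.
  (* The body contains its center: homogeneity with factor 2 forces f j z = 0. *)
  move=> p; have M0 : 0 <= M.
    have [_ e12 hf] := hA.
    have : A z.
      rewrite EA => j; have := hf j 2 z (ltr0Sn _ 1); rewrite /dilation subrr scaler0 addr0.
      have /andP[] := e12 j; case: (e j) => [//|[|[|//]]] _ _; rewrite ?expr1 ?expr2; lra.
    by move=> /cA/(_ ord0); apply: le_trans.
  apply: le_trans (_ : M + \sum_p `|theta p| <= _).
    rewrite (bigD1 p)//= addrCA lerDl addr_ge0// sumr_ge0//.
  by apply: le_trans (le_bound _) _; rewrite ler_nat leq_addr.
apply: (@reconstructible_regular R d #|P| m F G) => //.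
- move=> A B /FG[n nA] /FG[n' nB]; exists (n + n')%N; split.
    exact: GW (leq_addr _ _) nA.
  exact: GW (leq_addl _ _) nB.
- move=> n; have n0 : 0 <= n%:R :> R by [].
  have [C' C'0 hC'] := shell_le d n0.
  have /choice[c hc] : forall j, exists C : R, 0 <= C /\
      forall theta theta' x eps,
      (forall p, `|theta p| <= n%:R + 1) -> (forall p, `|theta' p| <= n%:R + 1) ->
      (forall p, `|theta' p - theta p| <= eps) -> cube (n%:R + 1) x -> 0 <= eps ->
      `|f theta j x| <= C /\ `|f theta' j x - f theta j x| <= C * eps.
    by move=> j; have [C C0 hC] := lf j (n%:R + 1); exists C; split.
  pose C := 1 + \sum_j c j.
  have cC j : c j <= C.
    rewrite /C (bigD1 j)//= addrCA lerDl addr_ge0// sumr_ge0// => i _.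
    by have [] := hc i.
  have C0 : 0 < C by rewrite ltr_pwDl// sumr_ge0// => i _; have [] := hc i.
  (* A perturbed parameter may define an unbounded set, hence the intersection with the cube. *)
  apply: (@covered_of_lipschitz _ _ _ P unit _ (fun _ theta =>
    [set x | forall j, f theta j x <= 1] `&` cube n%:R) n%:R (C' * C)).
  move=> A [theta [e [z [EA hA cA htheta]]]]; exists tt, theta; split=> //.
  move=> eps theta' eps0 eps1 close.
  have ht' p : `|theta' p| <= n%:R + 1.
    rewrite -(subrK (theta p) (theta' p)) addrC (le_trans (ler_normD _ _))//.
    by rewrite lerD// (le_trans (close p)).
  have ht p : `|theta p| <= n%:R + 1 by rewrite (le_trans (htheta p))// lerDl.
  have near x j : cube n%:R x -> `|f theta' j x - f theta j x| <= C * eps.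
    move=> hx; have [_ h] := hc j.
    have [|_ {}h] := h theta theta' x eps ht ht' close _ (ltW eps0).
      by move=> i; rewrite (le_trans (hx i))// lerDl.
    by rewrite (le_trans h)// ler_wpM2r// ltW.
  rewrite -mulrA; apply: le_trans (hC' _ _ e z (C * eps) hA _ _); first last.
  + by rewrite mulr_gt0.
  + by rewrite -EA.
  have Ce : 0 < C * eps by rewrite mulr_gt0.
  (* On the symmetric difference all [f theta j] are at most 1 + C * eps and one is at least 1 - C *
     eps: this is the shell of the unperturbed body. *)
  apply: le_lebesgue_rV => x [[Ax nDx]|[[Dx cx] nAx]].
    have cx := cA x Ax; split=> //; rewrite EA in Ax; split=> [j|].
      by apply: le_trans (Ax j) _; rewrite lerDl ltW.
    have /existsNP[j /negP] : ~ forall j, f theta' j x <= 1.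
      by move=> h; apply: nDx; split.
    rewrite -ltNge => hj; exists j.
    by have := near x j cx; rewrite ler_norml => /andP[? ?]; lra.
  split=> //; split=> [j|].
    by have := near x j cx; have := Dx j; rewrite ler_norml => ? /andP[? ?]; lra.
  have /existsNP[j /negP] : ~ forall j, f theta j x <= 1.
    by move=> h; apply: nAx; rewrite EA.
  by rewrite -ltNge => hj; exists j; lra.
- move=> A /hF[theta [e [z [M [-> hA _]]]]]; exact: homogeneous_body_regular hA.
Qed.

(** * Balls, rectangles, ellipsoids, simplices and intervals *)

Lemma continuous_bigsum (R : realType) (T : topologicalType) (I : Type)
    (s : seq I) (g : I -> T -> R) :
  (forall i, continuous (g i)) -> continuous (fun x => \sum_(i <- s) g i x).
Proof.
move=> cg x; elim: s => [|i s IH].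
  by under eq_fun do rewrite big_nil; exact: cvg_cst.
under eq_fun do rewrite big_cons.
exact: (cvgD (cg i x) IH).
Qed.

Lemma continuous_add (R : realType) (T : topologicalType) (f g : T -> R) :
  continuous f -> continuous g -> continuous (fun x => f x + g x).
Proof. by move=> cf cg x; exact: (cvgD (cf x) (cg x)). Qed.

Lemma continuous_mul (R : realType) (T : topologicalType) (f g : T -> R) :
  continuous f -> continuous g -> continuous (fun x => f x * g x).
Proof. by move=> cf cg x; exact: (cvgM (cf x) (cg x)). Qed.

Lemma continuous_const (R : realType) (T : topologicalType) (c : R) :
  continuous (fun _ : T => c).
Proof. by move=> x; exact: cvg_cst. Qed.

Lemma continuous_coord (R : realType) (d : nat) (i : 'I_d) :
  continuous (fun x : 'rV[R]_d => x 0 i).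
Proof. by move=> x; exact: coord_continuous. Qed.

Lemma reconstructible_balls (R : realType) (d : nat) :
  reconstructible (@lebesgue_measure_rV R d.+1) (@balls R d.+1) (2 * d.+1 + 3)%N.
Proof.
(* The parameters are the center and [r ^- 2], the factor that normalizes the level to 1. *)
pose P : finType := option 'I_d.+1.
pose f (theta : P -> R) (_ : unit) (x : 'rV[R]_d.+1) :=
  theta None * \sum_i (x 0 i - theta (Some i)) * (x 0 i - theta (Some i)).
apply: (@reconstructible_homogeneous R d _ P _ f).
- rewrite card_option card_ord; lia.
- move=> j; apply: param_lipschitzM; first exact: param_lipschitz_param.
  apply: param_lipschitz_sum => i; apply: param_lipschitzM;
    (apply: param_lipschitzD; first exact: param_lipschitz_coord);
    exact/param_lipschitzN/param_lipschitz_param.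
move=> _ [c [r [r0 ->]]].
pose theta (p : P) := if p is Some i then c 0 i else r ^- 2.
have q0 x : 0 <= \sum_i (x 0 i - c 0 i) * (x 0 i - c 0 i).
  by apply: sumr_ge0 => i _; rewrite -expr2 sqr_ge0.
have E x : (enorm (x - c) <= r) = (f theta tt x <= 1).
  rewrite /enorm /f /= mulrC ler_pdivrMr ?exprn_gt0// mul1r.
  have -> : r = Num.sqrt (r ^+ 2) by rewrite sqrtr_sqr gtr0_norm.
  rewrite ler_sqrt ?sqr_ge0// sqrtr_sqr gtr0_norm//; congr (_ <= _).
  by apply: eq_bigr => i _; rewrite !mxE expr2.
exists theta, (fun=> 2%N), c, (r + \sum_i `|c 0 i|); split.
- by apply/seteqP; split=> [x /= h [] |x /= /(_ tt)]; rewrite -?E// E.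
- split=> // [j|j s x s0].
    apply: continuous_mul; first exact: continuous_const.
    apply: continuous_bigsum => i.
    by apply: continuous_mul; (apply: continuous_add;
      [exact: continuous_coord|exact: continuous_const]).
  rewrite /f mulrCA; congr (_ * _); rewrite mulr_sumr; apply: eq_bigr => i _.
  rewrite !mxE /=; ring.
- move=> x /= xr i; have ci : `|c 0 i| <= \sum_i `|c 0 i|.
    by rewrite (bigD1 i)//= lerDl sumr_ge0.
  have xi : `|x 0 i - c 0 i| <= r.
    apply: le_trans xr; rewrite /enorm -sqrtr_sqr ler_sqrt.
      rewrite (bigD1 i)//= !mxE lerDl sumr_ge0// => j _; exact: sqr_ge0.
    by apply: sumr_ge0 => j _; exact: sqr_ge0.
  rewrite -(subrK (c 0 i) (x 0 i)) (le_trans (ler_normD _ _))// lerD//.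
Qed.

Lemma reconstructible_rectangles (R : realType) :
  reconstructible (@lebesgue_measure_rV R 2) (@axis_rectangles R) 9.
Proof.
pose P : finType := ('I_2 * bool)%type.
(* For each coordinate, the affine function carrying the side onto [-1, 1], and its negative: two
   parameters per coordinate. *)
pose f (theta : P -> R) (j : P) (x : 'rV[R]_2) :=
  (if j.2 then 1 else -1) * (theta (j.1, true) * x 0 j.1 + theta (j.1, false)).
apply: (@reconstructible_homogeneous R 1 _ P P f).
- by rewrite card_prod card_ord card_bool.
- move=> j; apply: param_lipschitzM; first exact: param_lipschitz_cst.
  apply: param_lipschitzD; last exact: param_lipschitz_param.
  apply: param_lipschitzM; first exact: param_lipschitz_param.
  exact: param_lipschitz_coord.
move=> _ [a [b [ab ->]]].
pose theta (p : P) := if p.2 then 2 / (b 0 p.1 - a 0 p.1)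
  else - (a 0 p.1 + b 0 p.1) / (b 0 p.1 - a 0 p.1).
have E i x : theta (i, true) * x + theta (i, false) =
    (2 * x - a 0 i - b 0 i) / (b 0 i - a 0 i).
  rewrite /theta /=; field; have := ab i; lra.
exists theta, (fun=> 1%N), (2^-1 *: (a + b)), (\sum_i (`|a 0 i| + `|b 0 i|)); split.
- apply/seteqP; split=> x /= h.
    move=> [i s]; have := h i; have := ab i; rewrite /f /= E => abi /andP[h1 h2].
    by case: s; rewrite ?mul1r ?mulN1r -?mulNr ler_pdivrMr ?mul1r; lra.
  move=> i; have := h (i, true); have := h (i, false); rewrite /f /= E.
  rewrite mul1r mulN1r -mulNr !ler_pdivrMr ?subr_gt0// !mul1r; lra.
- split=> // [j|[i s'] s x s0].
    apply: continuous_mul; first exact: continuous_const.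
    apply: continuous_add; last exact: continuous_const.
    by apply: continuous_mul; [exact: continuous_const|exact: continuous_coord].
  rewrite /f /= !E expr1 !mxE; field; have := ab i; lra.
- move=> x h i; have /andP[h1 h2] := h i.
  have := ler_norm (b 0 i); have := ler_norm (- a 0 i); rewrite normrN => h3 h4.
  apply: le_trans (_ : `|a 0 i| + `|b 0 i| <= _).
    by rewrite ler_norml; have := normr_ge0 (a 0 i); have := normr_ge0 (b 0 i); lra.
  by rewrite (bigD1 i)//= lerDl sumr_ge0// => j _; rewrite addr_ge0.
Qed.

Lemma quadratic_formE (R : realType) (d : nat) (Q : 'M[R]_d) (x : 'rV[R]_d) :
  quadratic_form Q x = \sum_i \sum_j Q i j * (x 0 i * x 0 j).
Proof.
rewrite /quadratic_form mxE exchange_big /=; apply: eq_bigr => j _.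
by rewrite !mxE mulr_suml; apply: eq_bigr => i _; ring.
Qed.

(** With y_i the i-th row of the inverse of [Q], the form at x + y_i and at x - y_i equals Q(x) +
    Q(y_i) + 2 x_i and Q(x) + Q(y_i) - 2 x_i. Both are nonnegative, which bounds each coordinate of
    [x]. *)
Lemma positive_definite_bounded (R : realType) (d : nat) (Q : 'M[R]_d) :
  positive_definite Q ->
  exists M : R, forall x, quadratic_form Q x <= 1 -> cube M x.
Proof.
move=> [QT Qpos].
have Q0 x : 0 <= quadratic_form Q x.
  have [->|/Qpos/ltW//] := eqVneq x 0.
  by rewrite /quadratic_form !mul0mx mxE.
have uQ : Q \in unitmx.
  rewrite -row_free_unit; apply: inj_row_free => v vQ; apply/eqP.
  by apply: contraT => /Qpos; rewrite /quadratic_form vQ mul0mx mxE ltxx.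
pose y i : 'rV[R]_d := delta_mx 0 i *m invmx Q.
have yQ i : y i *m Q = delta_mx 0 i by rewrite -mulmxA mulVmx// mulmx1.
have key x i (s : R) : s * s = 1 -> quadratic_form Q (x + s *: y i) =
    quadratic_form Q x + quadratic_form Q (y i) + 2 * s * x 0 i.
  move=> ss.
  have xy : x *m Q *m (y i)^T = (x 0 i)%:M.
    rewrite -{1}QT -mulmxA -trmx_mul yQ; apply/matrixP => a b.
    by rewrite !ord1 trmx_delta -colE !mxE.
  have yx : y i *m Q *m x^T = (x 0 i)%:M.
    by apply/matrixP => a b; rewrite !ord1 yQ -rowE !mxE.
  rewrite /quadratic_form linearD /= linearZ /= !mulmxDl !mulmxDr.
  rewrite -!scalemxAl -!scalemxAr xy yx scalerA ss scale1r !mxE eqxx /=.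
  ring.
exists (\sum_i (1 + quadratic_form Q (y i))) => x qx i.
apply: le_trans (_ : 1 + quadratic_form Q (y i) <= _); last first.
  by rewrite (bigD1 i)//= lerDl sumr_ge0// => j _; rewrite addr_ge0.
have := Q0 (x + 1 *: y i); have := Q0 (x + (-1) *: y i).
rewrite !key ?mulr1 ?mulrNN ?mulr1// ler_norml => h1 h2.
have h3 := Q0 (y i); apply/andP; split; lra.
Qed.

(** Numbers the six independent entries of a symmetric 3 x 3 matrix: 0, 1, 2 on the diagonal, and 3,
    4, 5 off it, where i + j takes the distinct values 1, 2, 3. With the center this makes 9
    parameters. *)
Definition sym3_index (i j : 'I_3) : 'I_6 :=
  inord (if i == j then val i else (2 + i + j)%N).

Lemma sym3_index_inj (i j i' j' : 'I_3) : sym3_index i j = sym3_index i' j' ->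
  (i, j) = (i', j') \/ (i, j) = (j', i').
Proof.
have idxE (a b : 'I_3) : (sym3_index a b : nat) = if a == b :> nat then a : nat else (2 + a + b)%N.
  have := ltn_ord a; have := ltn_ord b; rewrite /sym3_index => ? ?.
  by rewrite -val_eqE /= inordK //; case: eqP => h; lia.
move=> /(congr1 val) /=; rewrite !idxE.
have := ltn_ord i; have := ltn_ord j; have := ltn_ord i'; have := ltn_ord j'.
move=> h1 h2 h3 h4; do 2![case: eqP => ?] => ?;
have [[? ?]|[? ?]] : (i = i' :> nat /\ j = j' :> nat) \/
                     (i = j' :> nat /\ j = i' :> nat) by lia.
all: by [left; congr pair; apply/val_inj|right; congr pair; apply/val_inj].
Qed.

Lemma reconstructible_ellipsoids (R : realType) :
  reconstructible (@lebesgue_measure_rV R 3) (@ellipsoids R 3) 19.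
Proof.
pose P : finType := ('I_3 + 'I_6)%type.
pose f (theta : P -> R) (_ : unit) (x : 'rV[R]_3) := \sum_i \sum_j
  theta (inr (sym3_index i j)) *
  ((x 0 i - theta (inl i)) * (x 0 j - theta (inl j))).
apply: (@reconstructible_homogeneous R 2 _ P _ f).
- by rewrite card_sum !card_ord.
- move=> u; apply: param_lipschitz_sum => i; apply: param_lipschitz_sum => j.
  apply: param_lipschitzM; first exact: param_lipschitz_param.
  apply: param_lipschitzM;
    (apply: param_lipschitzD; first exact: param_lipschitz_coord);
    exact/param_lipschitzN/param_lipschitz_param.
move=> _ [c [Q [Qpos ->]]].
have [M hM] := positive_definite_bounded Qpos.
have /choice[q hq] : forall t : 'I_6, exists r, forall i j,
    sym3_index i j = t -> r = Q i j.
  move=> t; have [[i [j ij]]|h] := pselect (exists i j, sym3_index i j = t).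
    exists (Q i j) => i' j'; rewrite -ij => /sym3_index_inj[] [-> ->]//.
    by have [QT _] := Qpos; rewrite -[in RHS]QT mxE.
  by exists 0 => i j ij; exfalso; apply: h; exists i, j.
pose theta (p : P) := match p with inl i => c 0 i | inr t => q t end.
have E x : f theta tt x = quadratic_form Q (x - c).
  rewrite quadratic_formE /f; apply: eq_bigr => i _; apply: eq_bigr => j _.
  by rewrite /= (hq _ i j erefl) !mxE.
exists theta, (fun=> 2%N), c, (M + \sum_i `|c 0 i|); split.
- by apply/seteqP; split=> [x /= h [] |x /= /(_ tt)]; rewrite E.
- split=> // [u|[] s x s0].
    apply: continuous_bigsum => i; apply: continuous_bigsum => j.
    apply: continuous_mul; first exact: continuous_const.
    by apply: continuous_mul; (apply: continuous_add;
      [exact: continuous_coord|exact: continuous_const]).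
  rewrite /f mulr_sumr; apply: eq_bigr => i _.
  rewrite mulr_sumr; apply: eq_bigr => j _; rewrite !mxE /=; ring.
- move=> x /hM h i; have ci : `|c 0 i| <= \sum_i `|c 0 i|.
    by rewrite (bigD1 i)//= lerDl sumr_ge0.
  rewrite -(subrK (c 0 i) (x 0 i)) (le_trans (ler_normD _ _))// lerD//.
  by have := h i; rewrite !mxE.
Qed.

(** Homogeneous coordinates: barycentric coordinates become the solution of a linear system whose
    matrix has the lifted vertices as rows. *)
Definition lift_row (R : realType) (d : nat) (x : 'rV[R]_d) : 'rV[R]_d.+1 :=
  \row_j if unlift ord0 j is Some l then x 0 l else 1.

(** A simplex is the set where all barycentric coordinates are nonnegative. They all equal 1/n at
    the centroid, n being the number of vertices, so the functions 1 - n * beta_i are homogeneous of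
    degree 1 about it, and the simplex is where all are at most 1. *)
Lemma reconstructible_simplices (R : realType) (d : nat) :
  reconstructible (@lebesgue_measure_rV R d.+1) (@simplices R d.+1)
    (2 * d.+1 ^ 2 + 2 * d.+1 + 1)%N.
Proof.
pose P : finType := ('I_d.+1 * 'I_d.+1 + 'I_d.+1)%type.
pose g (theta : P -> R) (i : 'I_d.+1) (x : 'rV[R]_d.+1) :=
  \sum_l theta (inl (i, l)) * x 0 l + theta (inr i).
(* The functions 1 - n * beta_i sum to 0, so one of them is minus the sum of the others; this brings
   the parameter count down to D(D + 1) in dimension D. *)
pose f (theta : P -> R) (j : option 'I_d.+1) (x : 'rV[R]_d.+1) :=
  if j is Some i then g theta i x else - \sum_i g theta i x.
have lg i : param_lipschitz (fun theta => g theta i).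
  apply: param_lipschitzD; last exact: param_lipschitz_param.
  apply: param_lipschitz_sum => l; apply: param_lipschitzM.
    exact: param_lipschitz_param.
  exact: param_lipschitz_coord.
apply: (@reconstructible_homogeneous R d _ P _ f).
- by rewrite card_sum card_prod !card_ord; lia.
- by move=> [i|]; [exact: lg|exact/param_lipschitzN/param_lipschitz_sum].
move=> _ [p [pind ->]].
pose H : 'M[R]_d.+2 := \matrix_i lift_row (p i).
have liftE (x : 'rV[R]_d.+1) : lift_row x 0 ord0 = 1 /\
    forall l, lift_row x 0 (lift ord0 l) = x 0 l.
  by split=> [|l]; rewrite mxE ?unlift_none ?liftK.
have mulH (c : 'rV[R]_d.+2) (x : 'rV[R]_d.+1) : c *m H = lift_row x <->
    \sum_i c 0 i = 1 /\ x = \sum_i c 0 i *: p i.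
  have H0 : (c *m H) 0 ord0 = \sum_i c 0 i.
    rewrite mxE; apply: eq_bigr => i _; rewrite mxE.
    by have [-> _] := liftE (p i); rewrite mulr1.
  have H1 l : (c *m H) 0 (lift ord0 l) = (\sum_i c 0 i *: p i) 0 l.
    rewrite mxE summxE; apply: eq_bigr => i _; rewrite !mxE.
    by rewrite liftK.
  split=> [E|[E1 E2]].
    split; first by rewrite -H0 E; have [] := liftE x.
    by apply/rowP => l; rewrite -H1 E; have [_ ->] := liftE x.
  apply/rowP => j; have [l ->|->] := unliftP ord0 j.
    by rewrite H1 -E2; have [_ ->] := liftE x.
  by rewrite H0 E1; have [-> _] := liftE x.
have uH : H \in unitmx.
  rewrite -row_free_unit; apply: inj_row_free => v vH; apply/rowP => j.
  rewrite [RHS]mxE; apply: (pind (fun i => v 0 i)).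
    transitivity ((v *m H) 0 ord0); last by rewrite vH mxE.
    rewrite mxE; apply: eq_bigr => i _; rewrite mxE.
    by have [-> _] := liftE (p i); rewrite mulr1.
  apply/rowP => l; transitivity ((v *m H) 0 (lift ord0 l)).
    rewrite mxE summxE; apply: eq_bigr => i _; rewrite !mxE.
    by rewrite liftK.
  by rewrite vH !mxE.
pose beta x := lift_row x *m invmx H.
have betaH x : beta x *m H = lift_row x by rewrite -mulmxA mulVmx// mulmx1.
have beta_uniq x c : c *m H = lift_row x -> c = beta x.
  by move=> E; rewrite /beta -E -mulmxA mulmxV// mulmx1.
pose n : R := d.+2%:R; have n0 : 0 < n by rewrite ltr0n.
pose z := \sum_i n^-1 *: p i.
have betaz i : beta z 0 i = n^-1.
  rewrite -(beta_uniq z (const_mx n^-1)) ?mxE//; apply/mulH; split.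
    under eq_bigr do rewrite mxE.
    by rewrite sumr_const card_ord -mulr_natr mulVf// gt_eqF.
  by apply: eq_bigr => j _; rewrite mxE.
have beta_dil s x : beta (dilation z s x) = (1 - s) *: beta z + s *: beta x.
  apply/esym/beta_uniq; rewrite mulmxDl -!scalemxAl !betaH.
  apply/rowP => j; rewrite !mxE; case: (unlift ord0 j) => [l|]; rewrite ?mxE; ring.
pose theta (q : P) := match q with
  | inl (i, l) => - n * invmx H (lift ord0 l) (lift ord0 i)
  | inr i => 1 - n * invmx H ord0 (lift ord0 i) end.
have gE i x : g theta i x = 1 - n * beta x 0 (lift ord0 i).
  rewrite /g /beta mxE [in RHS]big_ord_recl; have [-> lx] := liftE x.
  under [in RHS]eq_bigr do rewrite lx.
  rewrite mul1r mulrDr opprD [RHS]addrA [LHS]addrC; congr (_ + _).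
  by rewrite mulr_sumr -sumrN; apply: eq_bigr => l _; rewrite /=; ring.
pose full (j : option 'I_d.+1) : 'I_d.+2 := if j is Some i then lift ord0 i else ord0.
have fE j x : f theta j x = 1 - n * beta x 0 (full j).
  case: j => [i|]; first exact: gE.
  have [sum1 _] := (mulH (beta x) x).1 (betaH x); rewrite big_ord_recl in sum1.
  rewrite /f.
  under eq_bigr do rewrite gE.
  rewrite sumrB -mulr_sumr sumr_const card_ord /=.
  have -> : \sum_i beta x 0 (lift ord0 i) = 1 - beta x 0 ord0.
    by rewrite -sum1 addrC addKr.
  have -> : n = d.+1%:R + 1 by rewrite /n -addn1 natrD.
  ring.
clearbody beta.
exists theta, (fun=> 1%N), z, (\sum_i \sum_l `|p i 0 l|); split.
- apply/seteqP; split=> [x [c [c0 [c1 cx]]] j|x xb].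
    rewrite fE gerBl mulr_ge0 ?(ltW n0)//.
    have <- : \row_i c i = beta x; last by rewrite mxE; exact: c0.
    apply/beta_uniq/mulH; split; first by under eq_bigr do rewrite mxE.
    by rewrite cx; apply: eq_bigr => i _; rewrite mxE.
  exists (beta x 0); split=> [i|]; last exact: (mulH (beta x) x).1 (betaH x).
  have [l il|i0] := unliftP ord0 i.
    have := xb (Some l); rewrite fE /= -il gerBl pmulr_rge0//.
  by have := xb None; rewrite fE /= -i0 gerBl pmulr_rge0.
- split=> // [j|j s x s0].
    have cg i : continuous (g theta i).
      apply: continuous_add; last exact: continuous_const.
      apply: continuous_bigsum => l; apply: continuous_mul.
        exact: continuous_const.
      exact: continuous_coord.
    case: j => [i|]; first exact: cg.
    have cs : continuous (fun x => \sum_i g theta i x) by exact: continuous_bigsum.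
    by move=> x; exact: cvgN (cs x).
  rewrite !fE beta_dil !mxE betaz expr1; field; by rewrite gt_eqF.
- move=> x [c [c0 [c1 ->]]] l; rewrite summxE (le_trans (ler_norm_sum _ _ _))//.
  apply: ler_sum => i _; rewrite mxE normrM.
  apply: le_trans (_ : `|p i 0 l| <= _).
    rewrite ler_piMl// ger0_norm// -c1 (bigD1 i)//= lerDl sumr_ge0//.
  by rewrite (bigD1 l)//= lerDl sumr_ge0.
Qed.

Lemma reconstructible_intervals (R : realType) :
  reconstructible (@lebesgue_measure R) (@intervals R) 5.
Proof.
(* Lebesgue measure written as the outer extension of interval length, which gives access to its
   outer measure structure and to the Caratheodory measurability of half-open intervals. *)
pose mu : {outer_measure set R -> \bar R} :=
  (((wlength (@idfun R))^*)%mu : {outer_measure set (ocitv_type R) -> \bar R}).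
have len (u v : R) (b1 b2 : bool) : u <= v ->
    mu [set` Interval (BSide b1 u) (BSide b2 v)] = (v - u)%:E.
  move=> uv; rewrite [LHS](lebesgue_measure_itv (Interval (BSide b1 u) (BSide b2 v))).
  rewrite /= lte_fin; case: ltP => [//|vu]; congr (_%:E); lra.
have cara (u v : R) : caratheodory_measurable mu `]u, v]%classic.
  have h := @caratheodory_measurable_mu_ext _ R (ocitv_type R) (wlength (@idfun R)) `]u, v]%classic (is_ocitv u v).
 exact: h.
pose U n : set R := let: (p, q) := odflt (0, 1) (unpickle n : option (rat * rat)) in
  if p < q then `](ratr p : R), ratr q]%classic else `]0%R, 1%R]%classic.
have U_basis (u v : R) : u < v -> exists n, U n `<=` `]u, v[%classic.
  move=> uv; have [q] := rat_in_itvoo uv; rewrite in_itv /= => /andP[uq qv].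
  have [p] := rat_in_itvoo uq; rewrite in_itv /= => /andP[up pq].
  exists (pickle (p, q)); rewrite /U pickleK /= -(ltr_rat R) pq.
  move=> x /=; rewrite !in_itv /= => /andP[? ?]; apply/andP; split; lra.
pose G (n : nat) : set (set R) := [set A | exists a b : R,
  [/\ A = `[a, b]%classic, a < b, `|a| <= n%:R & `|b| <= n%:R]].
apply: (@reconstructible_of_cover R R mu (@intervals R) 2 5 G U) => //.
- move=> _ _ [a [b [ab ->]]] [a' [b' [ab' ->]]].
  have le_bound (u : R) : `|u| <= (Num.bound u)%:R.
    exact/ltW/unstable.ltr_norm_bound.
  exists (Num.bound a + Num.bound b + Num.bound a' + Num.bound b')%N.
  by split; [exists a, b|exists a', b']; split=> //;
    apply: le_trans (le_bound _) _; rewrite ler_nat; lia.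
- move=> n; rewrite -card_bool.
  apply: (@covered_of_lipschitz _ _ mu bool unit _ (fun _ theta =>
    `[theta true, theta false]%classic) n%:R 4).
  move=> _ [a [b [-> ab an bn]]].
  exists tt, (fun c : bool => if c then a else b); split=> [[]//|].
  move=> eps theta' eps0 eps1 close.
  have := close true; have := close false => /=.
  rewrite !ler_norml => /andP[? ?] /andP[? ?].
  (* The symmetric difference lies within eps of the two endpoints, which gives the Lipschitz
     constant 4. *)
  pose V c : set R := `[c - eps, c + eps]%classic.
  have sub : `[a, b]%classic `+` `[theta' true, theta' false]%classic `<=` V a `|` V b.
    move=> x; rewrite /V /= !in_itv /=.
    move=> [[/andP[h1 h2]]|[/andP[h1 h2]]] /negP; rewrite negb_and -!ltNge => /orP[] h3;
    by [left; apply/andP; split; lra|right; apply/andP; split; lra].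
  apply: le_trans (le_outer_measure mu _ _ sub) _.
  apply: le_trans (outer_measureU2 _ _ _) _.
  by rewrite !len -?EFinD ?lee_fin; lra.
- move=> _ _ [a [b [ab ->]]] [a' [b' [ab' ->]]] ne.
  have key (c e c' e' : R) : c < e -> c' < e' -> c < c' \/ e' < e ->
      exists n, U n `<=` `[c, e]%classic `\` `[c', e']%classic.
    move=> ce ce' [cc'|ee'].
      have [|n hn] := U_basis c (Num.min c' e); first by rewrite lt_min cc'.
      exists n => x /hn; rewrite /= !in_itv /= lt_min => /andP[h1 /andP[h2 h3]].
      split; first by apply/andP; split; lra.
      by move=> /andP[h4 h5]; lra.
    have [|n hn] := U_basis (Num.max e' c) e; first by rewrite gt_max ee'.
    exists n => x /hn; rewrite /= !in_itv /= gt_max => /andP[/andP[h1 h2] h3].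
    split; first by apply/andP; split; lra.
    by move=> /andP[h4 h5]; lra.
  have [aa'|aa'|aa'] := ltgtP a a'.
  + by have [n hn] := key _ _ _ _ ab ab' (or_introl aa'); exists n; left.
  + by have [n hn] := key _ _ _ _ ab' ab (or_introl aa'); exists n; right.
  have [bb'|bb'|bb'] := ltgtP b b'.
  + by have [n hn] := key _ _ _ _ ab' ab (or_intror bb'); exists n; right.
  + by have [n hn] := key _ _ _ _ ab ab' (or_intror bb'); exists n; left.
  by exfalso; apply: ne; rewrite aa' bb'.
- move=> n tau tau0.
  have [p [q [pq ->]]] : exists p q : R, p < q /\ U n = `]p, q]%classic.
    rewrite /U; case: (odflt _ _) => p q; case: ifPn => pq.
      by exists (ratr p), (ratr q); rewrite ltr_rat.
    by exists 0, 1.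
  pose w := Num.min (q - p) tau.
  have w0 : 0 < w by rewrite lt_min subr_gt0 pq.
  have wq : w <= q - p by rewrite ge_min lexx.
  exists (fun s => `]p, (p + s * w)]%classic), w; split.
  + by rewrite w0 ge_min lexx orbT.
  + by move=> x /=; rewrite !in_itv /= => /andP[h1 h2]; apply/andP; split; lra.
  + move=> s /andP[s0 s1]; split; first exact: cara.
      move=> x /=; rewrite !in_itv /= => /andP[-> h] /=; rewrite (le_trans h)//.
      by rewrite lerD2l ler_pM2r.
    by rewrite len ?lerDl ?mulr_ge0 ?(ltW w0)// addrC addKr.
Qed.

(** * Polygons *)

Lemma bounded_setE (R : realType) (d : nat) (A : set 'rV[R]_d.+1) :
  bounded_set A <-> exists M : R, A `<=` cube M.
Proof.
have coord_le (x : 'rV[R]_d.+1) i : `|x 0 i| <= `|x|.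
  rewrite [leRHS]mx_normrE; apply: (le_bigmax _ (fun ij => `|x ij.1 ij.2|) (0, i)).
split=> [[M [_ hM]]|[M AM]].
  exists (M + 1) => x Ax i; apply: le_trans (coord_le x i) _.
  by apply: hM => //; rewrite ltrDl.
exists `|M|; split; first exact: num_real.
move=> N MN x Ax /=; rewrite -[leLHS]/(mx_norm x); have [E|/mx_norm_neq0[[i j] /= E]] := eqVneq (mx_norm x) 0.
  by rewrite E (le_trans _ (ltW MN)).
rewrite E ord1; apply: le_trans (AM x Ax j) _.
by rewrite (le_trans (ler_norm M))// ltW.
Qed.

Lemma segment_pointE (R : realType) (d : nat) (x y : 'rV[R]_d) (t : R) (i : 'I_d) :
  segment_point x y t 0 i = (1 - t) * x 0 i + t * y 0 i.
Proof. by rewrite !mxE. Qed.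

Lemma segment_point_continuous (R : realType) (d : nat) (x y : 'rV[R]_d) :
  continuous (segment_point x y).
Proof.
move=> t; apply: cvgD; apply: cvgZr_tmp; last exact: cvg_id.
by apply: cvgB; [exact: cvg_cst|exact: cvg_id].
Qed.

Lemma segment_component (R : realType) (d : nat) (A : set 'rV[R]_d) (x y : 'rV[R]_d) :
  (forall t, 0 <= t <= 1 -> A (segment_point x y t)) ->
  connected_component A x = connected_component A y.
Proof.
move=> h; apply: same_connected_component.
have e0 : segment_point x y 0 = x by rewrite /segment_point subr0 scale1r scale0r addr0.
have e1 : segment_point x y 1 = y by rewrite /segment_point subrr scale1r scale0r add0r.
apply: (@connected_component_max _ A (segment_point x y @` `[0, 1])).
- by exists 0 => //; rewrite /= in_itv /= lexx ler01.
- by move=> _ [t + <-]; rewrite /= in_itv /=; exact: h.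
- apply: connected_continuous_connected; first exact: segment_connected.
  apply: continuous_subspaceT; exact: segment_point_continuous.
- by exists 1 => //; rewrite /= in_itv /= lexx ler01.
Qed.

Definition edge (R : realType) (d : nat) (p q : 'rV[R]_d) : set 'rV[R]_d :=
  segment_point p q @` `[0, 1]%classic.

Lemma edge_closed (R : realType) (d : nat) (p q : 'rV[R]_d.+1) : closed (edge p q).
Proof.
apply: compact_closed; first exact: norm_hausdorff.
apply: continuous_compact; last exact: segment_compact.
apply: continuous_subspaceT; exact: segment_point_continuous.
Qed.

Lemma polygon_curveE (R : realType) (n : nat) (p : 'I_n -> 'rV[R]_2) x :
  polygon_curve p x <-> exists i, edge (p i) (p (ordS i)) x.
Proof.
split=> [[i [t [t01 ->]]]|[i [t /= + <-]]]; last by rewrite in_itv; exists i, t.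
by exists i, t => //; rewrite /= in_itv.
Qed.

Lemma near_not_edge (R : realType) (n : nat) (p : 'I_n -> 'rV[R]_2) (P : pred 'I_n) x :
  (forall i, P i -> ~ edge (p i) (p (ordS i)) x) ->
  \forall y \near x, forall i, P i -> ~ edge (p i) (p (ordS i)) y.
Proof.
move=> nx; have hi i : \forall y \near x, P i -> ~ edge (p i) (p (ordS i)) y.
  case: (boolP (P i)) => Pi; last by apply: (@filterS _ (nbhs x) _ setT); [|exact: filterT].
  have oE : open (~` edge (p i) (p (ordS i))) by exact/closed_openC/edge_closed.
  apply: (@filterS _ (nbhs x) _ (~` edge (p i) (p (ordS i)))) => [//|].
  exact: open_nbhs_nbhs (conj oE (nx i Pi)).
exact: (@filter_forall _ _ _ (nbhs x) _ hi).
Qed.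

Lemma polygon_curve_closed (R : realType) (n : nat) (p : 'I_n -> 'rV[R]_2) :
  closed (polygon_curve p).
Proof.
rewrite -[polygon_curve p]setCK; apply: open_closedC.
rewrite openE => x nx.
apply: (@filterS _ (nbhs x) _ [set y | forall i, xpredT i -> ~ edge (p i) (p (ordS i)) y]).
  by move=> y h /polygon_curveE[i]; exact: h.
by apply: near_not_edge => i _ xi; apply: nx; apply/polygon_curveE; exists i.
Qed.

Lemma region_segment (R : realType) (n : nat) (p : 'I_n -> 'rV[R]_2) (x y : 'rV[R]_2) :
  (forall t, 0 <= t <= 1 -> ~ polygon_curve p (segment_point x y t)) ->
  polygon_region p x <-> polygon_region p y.
Proof.
move=> h; have E := @segment_component R 2 (~` polygon_curve p) x y h.
have nx : ~ polygon_curve p x.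
  have := h 0; rewrite /segment_point subr0 scale1r scale0r addr0; apply.
  by rewrite lexx ler01.
have ny : ~ polygon_curve p y.
  have := h 1; rewrite /segment_point subrr scale1r scale0r add0r; apply.
  by rewrite lexx ler01.
by split=> -[//|[_ b]]; right; split=> //; [rewrite -E|rewrite E].
Qed.

Lemma region_locally_constant (R : realType) (n : nat) (p : 'I_n -> 'rV[R]_2) x :
  ~ polygon_curve p x ->
  \forall y \near x, ~ polygon_curve p y /\
    (polygon_region p x <-> polygon_region p y).
Proof.
move=> nx; have oC := closed_openC (@polygon_curve_closed R n p).
have /nbhs_ballP[e /= e0 eC] : nbhs x (~` polygon_curve p) by exact: open_nbhs_nbhs.
apply/nbhs_ballP; exists e => //= y xy; split; first exact: eC.
apply: region_segment => t /andP[t0 t1]; apply: eC; split=> // i j.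
have [_ /(_ i j)] := xy; rewrite /ball /= (ord1 i) segment_pointE => h.
have -> : x 0 j - ((1 - t) * x 0 j + t * y 0 j) = t * (x 0 j - y 0 j) by ring.
rewrite normrM ger0_norm//; apply: le_lt_trans h.
by rewrite ler_piMl.
Qed.

Lemma polygon_region_closed (R : realType) (n : nat) (p : 'I_n -> 'rV[R]_2) :
  closed (polygon_region p).
Proof.
rewrite -[polygon_region p]setCK; apply: open_closedC.
rewrite openE => x nx; have nc : ~ polygon_curve p x by move=> h; apply: nx; left.
by apply: (@filterS _ (nbhs x) _ _ _ _ (region_locally_constant nc)) => y [_ E] /E.
Qed.

Lemma polygon_region_interior (R : realType) (n : nat) (p : 'I_n -> 'rV[R]_2) x :
  ~ polygon_curve p x -> polygon_region p x -> interior (polygon_region p) x.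
Proof.
move=> nc rx.
by apply: (@filterS _ (nbhs x) _ _ _ _ (region_locally_constant nc)) => y [_ E]; apply/E.
Qed.

Lemma polygon_curve_cube (R : realType) (n : nat) (p : 'I_n -> 'rV[R]_2) (M : R) :
  (forall i, cube M (p i)) -> polygon_curve p `<=` cube M.
Proof.
move=> pM x [i [t [/andP[t0 t1] ->]]] j; rewrite segment_pointE.
have := pM i j; have := pM (ordS i) j; rewrite !ler_norml.
move=> /andP[? ?] /andP[? ?]; apply/andP; split; nra.
Qed.

(** From a point outside the cube, moving outwards along a coordinate that exceeds [M] in absolute
    value never meets the curve, so the component of the point is unbounded. The shift by [|N| + 1]
    in the proof passes any proposed bound [N]. *)
Lemma polygon_region_cube (R : realType) (n : nat) (p : 'I_n -> 'rV[R]_2) (M : R) :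
  (forall i, cube M (p i)) -> polygon_region p `<=` cube M.
Proof.
move=> pM x [/(polygon_curve_cube pM)//|[nx /bounded_setE[N bN]]] j.
rewrite leNgt; apply/negP => xM.
pose s : R := if 0 <= x 0 j then 1 else -1.
have ss : s * s = 1 by rewrite /s; case: ifP => _; rewrite ?mulrNN mulr1.
have sx : s * x 0 j = `|x 0 j|.
  rewrite /s; case: ifP => [h|/negbT]; first by rewrite mul1r ger0_norm.
  by rewrite -ltNge => h; rewrite mulN1r ltr0_norm.
have sle u : s * u <= `|u|.
  apply: le_trans (ler_norm _) _; rewrite normrM.
  by rewrite /s; case: ifP => _; rewrite ?normrN normr1 mul1r.
pose y : 'rV[R]_2 := x + (s * (`|N| + 1)) *: delta_mx 0 j.
have sy : s * y 0 j = `|x 0 j| + (`|N| + 1).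
  by rewrite !mxE !eqxx mulr1 mulrDr sx mulrA ss mul1r.
have xy : connected_component (~` polygon_curve p) x y.
  rewrite (@segment_component R 2 (~` polygon_curve p) x y).
    apply: connected_component_refl => /(polygon_curve_cube pM)/(_ j).
    have := sle (y 0 j); have := normr_ge0 N; rewrite sy; lra.
  move=> t /andP[t0 t1] /(polygon_curve_cube pM)/(_ j).
  rewrite segment_pointE => h.
  have := le_trans (sle _) h; rewrite mulrDr !(mulrCA s) sx sy.
  have : 0 <= t * (`|N| + 1) by rewrite mulr_ge0// addr_ge0.
  lra.
have := bN y xy j; have := sle (y 0 j); have := ler_norm N; rewrite sy.
have := normr_ge0 (x 0 j); lra.
Qed.

(** * Crossing parity *)

(** The cross product of q - p and x - p, twice the signed area of the triangle p, q, x. *)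
Definition side (R : realType) (p q x : 'rV[R]_2) : R :=
  (q 0 0 - p 0 0) * (x 0 1 - p 0 1) - (q 0 1 - p 0 1) * (x 0 0 - p 0 0).

Lemma side_continuous (R : realType) (p q : 'rV[R]_2) : continuous (side p q).
Proof.
apply: continuous_add.
  apply: continuous_mul; first exact: continuous_const.
  by apply: continuous_add; [exact: continuous_coord|exact: continuous_const].
have c : continuous (fun x : 'rV[R]_2 => (q 0 1 - p 0 1) * (x 0 0 - p 0 0)).
  apply: continuous_mul; first exact: continuous_const.
  by apply: continuous_add; [exact: continuous_coord|exact: continuous_const].
by move=> x; exact: cvgN (c x).
Qed.

Lemma side_segment_point (R : realType) (p q x y : 'rV[R]_2) (t : R) :
  side p q (segment_point x y t) = (1 - t) * side p q x + t * side p q y.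
Proof. rewrite /side !segment_pointE; ring. Qed.

Lemma rV2P (R : realType) (x y : 'rV[R]_2) : x 0 0 = y 0 0 -> x 0 1 = y 0 1 -> x = y.
Proof.
move=> h0 h1; apply/rowP => -[[|[|//]] i2].
  by rewrite (_ : Ordinal i2 = 0) //; exact/val_inj.
by rewrite (_ : Ordinal i2 = 1) //; exact/val_inj.
Qed.

(* The vertex [p] lies above the horizontal line through [y]; ties count as
   below, which makes the crossing parity right also at the heights of the
   vertices. *)
Definition above (R : realType) (p y : 'rV[R]_2) : bool := y 0 1 < p 0 1.

(* The edge from [p] to [q] meets the horizontal ray from [y] to the right. *)
Definition crosses (R : realType) (p q y : 'rV[R]_2) : bool :=
  (above p y != above q y) &&
  (if above q y then 0 < side p q y else side p q y < 0).

(* When [y] moves away from [x], the vertex [p], on the right of [x] at the same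
   height, passes to the other side of the ray. *)
Definition passes (R : realType) (p x y : 'rV[R]_2) : bool :=
  [&& p 0 1 == x 0 1, x 0 0 < p 0 0 & above p y].

(** The hypotheses say that strict inequalities at [x] persist at [y]. Off the edge, the crossing
    can then change only through an endpoint at the height of [x] and to its right, which [passes]
    records; around the polygon these terms cancel in pairs. *)
Lemma crosses_perturb (R : realType) (p q x y : 'rV[R]_2) : ~ edge p q x ->
  (p 0 1 < x 0 1 -> p 0 1 < y 0 1) -> (x 0 1 < p 0 1 -> y 0 1 < p 0 1) ->
  (q 0 1 < x 0 1 -> q 0 1 < y 0 1) -> (x 0 1 < q 0 1 -> y 0 1 < q 0 1) ->
  (0 < side p q x -> 0 < side p q y) -> (side p q x < 0 -> side p q y < 0) ->
  crosses p q y = crosses p q x (+) (passes p x y (+) passes q x y).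
Proof.
move=> nx pb pa qb qa sp sn.
have onE (t : R) : 0 <= t <= 1 -> x 0 0 = (1 - t) * p 0 0 + t * q 0 0 ->
    x 0 1 = (1 - t) * p 0 1 + t * q 0 1 -> False.
  move=> t01 h0 h1; apply: nx; exists t; first by rewrite /= in_itv.
  by apply: rV2P; rewrite segment_pointE.
have noside : (p 0 1 < x 0 1 < q 0 1) || (q 0 1 < x 0 1 < p 0 1) -> side p q x <> 0.
  move=> h s0; pose t := (x 0 1 - p 0 1) / (q 0 1 - p 0 1).
  have ne : q 0 1 - p 0 1 != 0 by case/orP: h => /andP[? ?]; lra.
  apply: (onE t).
  - rewrite /t; case/orP: h => /andP[h1 h2].
      by rewrite ler_pdivrMr ?divr_ge0; lra.
    rewrite -mulrNN -invrN.
    by rewrite ler_pdivrMr ?divr_ge0; lra.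
  - apply: (mulfI ne); rewrite /t.
    transitivity ((q 0 1 - p 0 1) * p 0 0 + (x 0 1 - p 0 1) * (q 0 0 - p 0 0)).
      move: s0; rewrite /side; lra.
    by field.
  - by rewrite /t; field.
(* A horizontal edge at the height of [x] lies entirely to one side of [x], so both endpoints pass
   or neither does. *)
have nox : p 0 1 = x 0 1 -> q 0 1 = x 0 1 -> (x 0 0 < p 0 0) = (x 0 0 < q 0 0).
  move=> p1 q1; have key (t : R) : 0 <= t <= 1 -> x 0 0 = (1 - t) * p 0 0 + t * q 0 0 -> False.
    move=> t01 h0; apply: (onE t) => //; rewrite p1 q1; ring.
  have [e|ne] := eqVneq (p 0 0) (q 0 0); first by rewrite e.
  pose t := (x 0 0 - p 0 0) / (q 0 0 - p 0 0).
  have ne' : q 0 0 - p 0 0 != 0 by rewrite subr_eq0 eq_sym.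
  have ht : x 0 0 = (1 - t) * p 0 0 + t * q 0 0 by rewrite /t; field.
  have nt : ~ (0 <= t <= 1) by move=> /key /(_ ht).
  apply/idP/idP => h; rewrite ltNge; apply/negP => h'; apply: nt; rewrite /t.
    rewrite -mulrNN -invrN.
    by rewrite ler_pdivrMr ?divr_ge0; lra.
  by rewrite ler_pdivrMr ?divr_ge0; lra.
have px : p 0 1 = x 0 1 -> p 0 0 <> x 0 0.
  by move=> h1 h0; apply: (onE 0); rewrite ?lexx ?ler01// ?h0 ?h1; ring.
have qx : q 0 1 = x 0 1 -> q 0 0 <> x 0 0.
  by move=> h1 h0; apply: (onE 1); rewrite ?lexx ?ler01// ?h0 ?h1; ring.
rewrite /crosses /passes /above.
have below (r : 'rV[R]_2) : r 0 1 < y 0 1 -> (y 0 1 < r 0 1) = false.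
  by move=> h; rewrite ltNge ltW.
have sgn (b : bool) : (b -> 0 < side p q y) -> (~~ b -> side p q y < 0) ->
    ((0 < side p q y) = b) * ((side p q y < 0) = ~~ b).
  case: b => /= hp hn; split.
  - exact: hp.
  - by rewrite ltNge ltW// hp.
  - by rewrite ltNge ltW// hn.
  - exact: hn.
have sgnN (b : bool) : (b -> side p q y < 0) -> (~~ b -> 0 < side p q y) ->
    (side p q y < 0) = b.
  by move=> hn hp; rewrite (@sgn (~~ b) hp _).2 ?negbK.
have neqlt (u v : R) : u <> v -> ~~ (u < v) -> v < u.
  by move=> uv; rewrite -leNgt le_eqVlt => /orP[/eqP/esym|].
have [h1|h1|h1] := ltgtP (p 0 1) (x 0 1); have [h2|h2|h2] := ltgtP (q 0 1) (x 0 1) => /=.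
- by rewrite !below ?pb ?qb.
- rewrite (below p) ?pb// qa//=.
  have ns : side p q x <> 0 by apply: noside; rewrite h1 h2.
  have [e1 _] := @sgn (0 < side p q x) sp (fun h => sn (neqlt _ _ (nesym ns) h)).
  by rewrite e1 addbF.
- rewrite (below p) ?pb//=; case: (y 0 1 < q 0 1) => /=. 2: by rewrite andbF.
  rewrite andbT; apply: (@sgn (x 0 0 < q 0 0) _ _).1 => h.
    by apply: sp; rewrite /side h2; nra.
  by apply: sn; have := neqlt _ _ (nesym (qx h2)) h; rewrite /side h2; nra.
- rewrite pa// (below q) ?qb//=.
  have ns : side p q x <> 0 by apply: noside; rewrite h1 h2 orbT.
  have [_ e1] := @sgn (~~ (side p q x < 0)) (fun h => sp (neqlt _ _ ns h))
    (fun h => sn (negbNE h)).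
  by rewrite e1 negbK addbF.
- by rewrite pa// qa.
- have e1 : (side p q x < 0) = (x 0 0 < q 0 0).
    have := qx h2; rewrite /side h2 => ne; apply/idP/idP => h; last by nra.
    by rewrite ltNge; apply/negP => h'; nra.
  rewrite pa//= e1; case: (y 0 1 < q 0 1) => /=; first by rewrite andbT addbb.
  rewrite andbF addbF -e1; apply: sgnN => // h; apply: sp.
  have := neqlt _ _ (nesym (qx h2)); rewrite -e1 => /(_ h) {}h.
  by rewrite /side h2; nra.
- rewrite (below q) ?qb//=; case: (y 0 1 < p 0 1) => /=; last by rewrite andbF.
  rewrite andbT addbF; apply: sgnN => h.
    by apply: sn; rewrite /side -h1; nra.
  by apply: sp; have := neqlt _ _ (nesym (px h1)) h; rewrite /side -h1; nra.
- have e1 : (0 < side p q x) = (x 0 0 < p 0 0).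
    have := px h1; rewrite /side h1 => ne; apply/idP/idP => h; last by nra.
    by rewrite ltNge; apply/negP => h'; nra.
  rewrite qa//= e1; case: (y 0 1 < p 0 1) => /=; first by rewrite andbT addbF addbb.
  rewrite andbF !addbF -e1; apply: (@sgn _ _ _).1 => [|h]; [exact: sp|apply: sn].
  have := neqlt _ _ (nesym (px h1)); rewrite -e1 => /(_ h) {}h.
  by rewrite /side h1; nra.
- by rewrite h1 h2 eqxx /= (nox h1 h2) addbb.
Qed.

Lemma near_compare (R : realType) (g : 'rV[R]_2 -> R) (c : R) (x : 'rV[R]_2) :
  continuous g ->
  \forall y \near x, (c < g x -> c < g y) /\ (g x < c -> g y < c).
Proof.
move=> cg; have [h|h|h] := ltgtP (g x) c.
- by apply: (@filterS _ (nbhs x) _ _ _ _ (cvgr_lt _ (cg x) _ h)).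
- by apply: (@filterS _ (nbhs x) _ _ _ _ (cvgr_gt _ (cg x) _ h)).
- by apply: (@filterS _ (nbhs x) _ setT) => //; exact: filterT.
Qed.

Lemma crosses_near (R : realType) (p q x : 'rV[R]_2) : ~ edge p q x ->
  \forall y \near x,
    crosses p q y = crosses p q x (+) (passes p x y (+) passes q x y).
Proof.
move=> nx.
have hp := near_compare (p 0 1) x (@continuous_coord R 2 1).
have hq := near_compare (q 0 1) x (@continuous_coord R 2 1).
have hs := near_compare 0 x (@side_continuous R p q).
apply: (@filterS _ (nbhs x) _ _ _ _ (filterI hp (filterI hq hs))).
by move=> y [[? ?] [[? ?] [? ?]]]; exact: crosses_perturb.
Qed.

Definition crossing_parity (R : realType) (n : nat) (p : 'I_n -> 'rV[R]_2)
  (y : 'rV[R]_2) : bool := \big[addb/false]_i crosses (p i) (p (ordS i)) y.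

(** Each vertex ends one edge and begins the next, so its contribution appears twice and cancels
    modulo 2. *)
Lemma big_addb_ordS (n : nat) (F : 'I_n -> bool) :
  \big[addb/false]_i (F i (+) F (ordS i)) = false.
Proof.
have E : \big[addb/false]_i F i = \big[addb/false]_i F (ordS i).
  by rewrite (reindex_inj (@ordS_inj n)).
by rewrite big_split /= -E addbb.
Qed.

Lemma crossing_parity_near (R : realType) (n : nat) (p : 'I_n -> 'rV[R]_2) x :
  ~ polygon_curve p x ->
  \forall y \near x, crossing_parity p y = crossing_parity p x.
Proof.
move=> nx; have hi i : \forall y \near x, crosses (p i) (p (ordS i)) y =
    crosses (p i) (p (ordS i)) x (+) (passes (p i) x y (+) passes (p (ordS i)) x y).
  by apply: crosses_near => xi; apply: nx; apply/polygon_curveE; exists i.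
apply: (@filterS _ (nbhs x) _ _ _ _ (@filter_forall _ _ _ (nbhs x) _ hi)).
move=> y h; rewrite /crossing_parity (eq_bigr _ (fun i _ => h i)) big_split /=.
by rewrite (big_addb_ordS (fun i => passes (p i) x y)) addbF.
Qed.

(** From above, below or to the right of the cube the ray meets no edge. From the left it meets
    exactly the edges whose endpoints lie on different sides of its line, and a closed cycle has an
    even number of these. *)
Lemma crossing_parity_outside (R : realType) (n : nat) (p : 'I_n -> 'rV[R]_2)
    (M : R) (y : 'rV[R]_2) :
  (forall i, cube M (p i)) -> ~ cube M y -> crossing_parity p y = false.
Proof.
move=> pM ny.
have pM0 i : - M <= p i 0 0 <= M by rewrite -ler_norml; exact: pM.
have pM1 i : - M <= p i 0 1 <= M by rewrite -ler_norml; exact: pM.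
have [hy|hy] := ltP M (y 0 1).
  rewrite /crossing_parity big1// => i _; rewrite /crosses /above.
  have /andP[_ a1] := pM1 i; have /andP[_ a2] := pM1 (ordS i).
  by rewrite !(ltNge (y 0 1)) (ltW (le_lt_trans a1 hy)) (ltW (le_lt_trans a2 hy)).
have [hy'|hy'] := ltP (y 0 1) (- M).
  rewrite /crossing_parity big1// => i _; rewrite /crosses /above.
  have /andP[a1 _] := pM1 i; have /andP[a2 _] := pM1 (ordS i).
  by rewrite (lt_le_trans hy' a1) (lt_le_trans hy' a2).
have [hx|hx] := ltP M (y 0 0).
  rewrite /crossing_parity big1// => i _; rewrite /crosses /above.
  have /andP[_ a1] := pM0 i; have /andP[_ a2] := pM0 (ordS i).
  rewrite /side; set p0 := p i 0 0 in a1 *; set q0 := p (ordS i) 0 0 in a2 *.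
  set p1 := p i 0 1; set q1 := p (ordS i) 0 1.
  have [h1|h1] := ltP (y 0 1) p1; have [h2|h2] := ltP (y 0 1) q1 => //=.
    by apply/negP => h; have [h3|h3] := leP q0 p0; nra.
  by apply/negP => h; have [h3|h3] := leP q0 p0; nra.
have hx' : y 0 0 < - M.
  rewrite ltNge; apply/negP => h; apply: ny => -[[|[|//]] i2]; rewrite ler_norml.
    by rewrite (_ : Ordinal i2 = 0) ?h ?hx //; exact/val_inj.
  by rewrite (_ : Ordinal i2 = 1) ?hy' ?hy //; exact/val_inj.
rewrite -[RHS](big_addb_ordS (fun i => above (p i) y)); apply: eq_bigr => i _.
rewrite /crosses /above.
have /andP[a1 _] := pM0 i; have /andP[a2 _] := pM0 (ordS i).
rewrite /side; set p0 := p i 0 0 in a1 *; set q0 := p (ordS i) 0 0 in a2 *.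
set p1 := p i 0 1; set q1 := p (ordS i) 0 1.
have [h1|h1] := ltP (y 0 1) p1; have [h2|h2] := ltP (y 0 1) q1 => //=.
  by have [h3|h3] := leP q0 p0; nra.
by have [h3|h3] := leP q0 p0; nra.
Qed.

(** Parity is locally constant off the curve, hence constant on components, and it is even outside a
    cube; a component with odd parity stays inside that cube. *)
Lemma odd_parity_region (R : realType) (n : nat) (p : 'I_n -> 'rV[R]_2) x :
  ~ polygon_curve p x -> crossing_parity p x -> polygon_region p x.
Proof.
move=> nx odd; right; split=> //.
set C := connected_component _ x.
have odd_nbhs (b : bool) : open [set y | ~ polygon_curve p y /\ crossing_parity p y = b].
  rewrite openE => y [ny yb].
  have oC := closed_openC (@polygon_curve_closed R n p).
  apply: (@filterS _ (nbhs y) _ _ _ _ (filterI (open_nbhs_nbhs (conj oC ny))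
    (crossing_parity_near ny))) => z [nz zy]; split=> //.
  by rewrite zy.
have CN : C `<=` ~` polygon_curve p by exact: connected_component_sub.
have oddC : C `&` [set y | crossing_parity p y] = C.
  apply: (@component_connected _ (~` polygon_curve p) x).
  - by exists x; split=> //; exact: connected_component_refl.
  - exists [set y | ~ polygon_curve p y /\ crossing_parity p y = true] => //.
    by apply/seteqP; split=> y [Cy] => [h|[_ h]]; do ?split=> //; exact: CN.
  - exists (~` [set y | ~ polygon_curve p y /\ crossing_parity p y = false]).
      exact: open_closedC.
    apply/seteqP; split=> y [Cy h]; split=> //; first by move=> [_]; rewrite h.
    by apply: contrapT => /negP/negbTE h'; apply: h; split=> //; exact: CN.
pose M := \sum_i \sum_j `|p i 0 j|.
have pM i : cube M (p i).
  move=> j; rewrite /M (bigD1 i)//= (bigD1 j)//= -addrA lerDl.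
  by rewrite addr_ge0// ?sumr_ge0// => k _; rewrite sumr_ge0.
apply/bounded_setE; exists M => y; rewrite -/C -oddC => -[Cy oy].
by apply: contrapT => ny; move: oy; rewrite /= (crossing_parity_outside pM ny).
Qed.

Lemma ordS_neq (n : nat) (i : 'I_n) : (1 < n)%N -> ordS i != i.
Proof.
move=> n1; apply/eqP => /(congr1 val) /=; have := ltn_ord i.
have [h|h] := ltnP i.+1 n; first by rewrite modn_small// => _; lia.
move=> h'; have -> : i.+1 = n by lia.
by rewrite modnn; lia.
Qed.

Lemma segment_point0 (R : realType) (d : nat) (p q : 'rV[R]_d) : segment_point p q 0 = p.
Proof. by rewrite /segment_point subr0 scale1r scale0r addr0. Qed.

Lemma segment_point1 (R : realType) (d : nat) (p q : 'rV[R]_d) : segment_point p q 1 = q.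
Proof. by rewrite /segment_point subrr scale1r scale0r add0r. Qed.

Lemma simple_polygon_neq (R : realType) (n : nat) (p : 'I_n -> 'rV[R]_2) (i : 'I_n) :
  (1 < n)%N -> simple_polygon p -> p i <> p (ordS i).
Proof.
move=> n1 sp E; have [/eqP + _] : ordS i = i /\ 0 = 0 :> R.
  by apply: sp; rewrite ?lexx ?ltr01// !segment_point0.
by rewrite (negbTE (ordS_neq i n1)).
Qed.

Lemma simple_polygon_edge (R : realType) (n : nat) (p : 'I_n -> 'rV[R]_2)
    (i j : 'I_n) (t : R) : simple_polygon p -> 0 < t < 1 -> j != i ->
  ~ edge (p j) (p (ordS j)) (segment_point (p i) (p (ordS i)) t).
Proof.
move=> sp /andP[t0 t1] ji [s]; rewrite /= in_itv /= => /andP[s0].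
rewrite le_eqVlt => /orP[/eqP ->|s1] E.
  (* The final point of edge [j] is the initial point of edge [ordS j], the form in which
     [simple_polygon] can be applied to it. *)
  have [_ /eqP] : ordS j = i /\ 0 = t.
    by apply: sp; rewrite ?lexx ?ltr01 ?(ltW t0)// segment_point0 -E segment_point1.
  by rewrite lt_eqF.
have [ji' _] : j = i /\ s = t by apply: sp; rewrite ?s0 ?(ltW t0).
by rewrite ji' eqxx in ji.
Qed.

(* The parity of the crossings of the other edges, corrected by the passages
   through the vertices, is constant near an inner point of an edge. *)
Lemma crossing_parity_near_edge (R : realType) (n : nat) (p : 'I_n -> 'rV[R]_2)
    (i : 'I_n) (x : 'rV[R]_2) :
  (forall j, j != i -> ~ edge (p j) (p (ordS j)) x) ->
  exists b : bool, \forall y \near x,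
    (forall j, j != i -> ~ edge (p j) (p (ordS j)) y) /\
    crossing_parity p y = b (+) (crosses (p i) (p (ordS i)) y (+)
      (passes (p i) x y (+) passes (p (ordS i)) x y)).
Proof.
move=> nx; exists (\big[addb/false]_(j | j != i) crosses (p j) (p (ordS j)) x).
have hj j : \forall y \near x, j != i -> crosses (p j) (p (ordS j)) y =
    crosses (p j) (p (ordS j)) x (+) (passes (p j) x y (+) passes (p (ordS j)) x y).
  case: (boolP (j != i)) => ji.
    by apply: (@filterS _ (nbhs x) _ _ _ _ (crosses_near (nx j ji))).
  by apply: (@filterS _ (nbhs x) _ setT) => //; exact: filterT.
apply: (@filterS _ (nbhs x) _ _ _ _
  (filterI (near_not_edge nx) (@filter_forall _ _ _ (nbhs x) _ hj))).
move=> y [ny h]; split=> //; rewrite /crossing_parity (bigD1 i)//=.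
rewrite (eq_bigr _ (fun j ji => h j ji)) big_split /=.
have := big_addb_ordS (fun j => passes (p j) x y); rewrite (bigD1 i)//=.
set c := crosses _ _ _; set s := bigop _ _ _; set u := bigop _ _ _.
set v := passes _ _ _; set w := passes _ _ _.
by case: c; case: s; case: u; case: v; case: w.
Qed.

(** Near an inner point of an edge the parity takes both values, and odd points off the curve are
    interior to the region. Vertices are limits of inner points. *)
Lemma curve_sub_closure_interior (R : realType) (n : nat) (p : 'I_n -> 'rV[R]_2) :
  (1 < n)%N -> simple_polygon p ->
  polygon_curve p `<=` closure (interior (polygon_region p)).
Proof.
move=> n1 sp _ [i [t0 [/andP[t00 t01] ->]]] B Bx0.
set P := p i in Bx0 *; set Q := p (ordS i) in Bx0 *; set sg := segment_point P Q in Bx0 *.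
(* The parameter is moved slightly towards 1/2, since [t0] may be an end of [0, 1]. *)
have [t t01' Bx] : exists2 t, 0 < t < 1 & interior B (sg t).
  have Bx0' : nbhs (sg t0) (interior B) by exact: nbhs_interior.
  have /nbhs_ballP[e /= e0 he] := @segment_point_continuous R 2 P Q t0 _ Bx0'.
  pose s := Num.min 2^-1 (e / 2).
  have s0 : 0 < s by rewrite lt_min invr_gt0 ltr0n divr_gt0.
  have s1 : s <= 2^-1 by rewrite ge_min lexx.
  have s2 : s <= e / 2 by rewrite ge_min lexx orbT.
  exists (t0 + s * (2^-1 - t0)); first by apply/andP; split; nra.
  apply: he; rewrite /ball /= ltr_norml; apply/andP; split; nra.
set x := sg t in Bx.
have PQ : P <> Q by exact: simple_polygon_neq.
have nx j : j != i -> ~ edge (p j) (p (ordS j)) x by exact: simple_polygon_edge.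
have [b hb] := crossing_parity_near_edge nx.
have nb := @filterI _ (nbhs x) (nbhs_filter x) _ _ Bx hb.
have [e /= e0 he] := (nbhs_ballP _ _).1 nb.
have /andP[tt0 tt1] := t01'.
have xk k : x 0 k = (1 - t) * P 0 k + t * Q 0 k by rewrite segment_pointE.
clearbody x.
(* Among two points close to [x], one has odd crossing parity. *)
suff [y1 [y2 [b1 b2 [ne1 ne2] dif]]] : exists y1 y2 : 'rV[R]_2,
    [/\ ball x e y1, ball x e y2, side P Q y1 <> 0 /\ side P Q y2 <> 0 &
    crosses P Q y1 (+) (passes P x y1 (+) passes Q x y1) !=
    crosses P Q y2 (+) (passes P x y2 (+) passes Q x y2)].
  have done (y : 'rV[R]_2) : ball x e y -> side P Q y <> 0 -> crossing_parity p y ->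
      (interior (polygon_region p) `&` B) !=set0.
    move=> by_ sy odd; have [By [ny _]] := he y by_.
    have nc : ~ polygon_curve p y.
      move=> /polygon_curveE[j]; have [->|ji] := eqVneq j i; last exact: ny.
      move=> [u _ E]; apply: sy; rewrite -E side_segment_point /side; ring.
    exists y; split; last exact: By.
    apply: polygon_region_interior => //; exact: odd_parity_region.
  have [_ [_ h1]] := he _ b1; have [_ [_ h2]] := he _ b2.
  have : crossing_parity p y1 || crossing_parity p y2.
    by rewrite h1 h2; move: dif; case: b {hb he nb h1 h2}; do 2!case: (_ (+) _).
  by move=> /orP[/(done _ b1 ne1)|/(done _ b2 ne2)].
pose mv (k : 'I_2) (s : R) : 'rV[R]_2 := \row_j (x 0 j + (if j == k then s else 0)).
have mvb k s : `|s| < e -> ball x e (mv k s).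
  move=> se; split=> // u j; rewrite /ball /= (ord1 u) mxE opprD addrA subrr add0r normrN.
  by case: eqP => // _; rewrite normr0.
have e2 : `|e / 2| < e by rewrite gtr0_norm ?divr_gt0//; lra.
have e2' : `|- (e / 2)| < e by rewrite normrN.
have side_mv k s : side P Q (mv k s) =
    if k == 1 then (Q 0 0 - P 0 0) * s else - (Q 0 1 - P 0 1) * s.
  rewrite /side !mxE !xk; case: k => [[|[|//]]] k2 /=; ring.
have nz (u s : R) : u != 0 -> s != 0 -> u * s <> 0.
  by move=> u0 s0; apply/eqP; rewrite mulf_neq0.
have e20 : e / 2 != 0 by rewrite gt_eqF// divr_gt0.
have e20' : - (e / 2) != 0 by rewrite oppr_eq0.
(* Horizontal edge: [x] is moved up and down. The edge itself is never crossed, but exactly one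
   endpoint lies to the right of [x], and it passes only when moving down. *)
have [PQ1|PQ1] := eqVneq (P 0 1) (Q 0 1).
  have PQ0 : Q 0 0 - P 0 0 != 0.
    by rewrite subr_eq0; apply/eqP => h; apply: PQ; exact: rV2P.
  exists (mv 1 (e / 2)), (mv 1 (- (e / 2))); split; [exact: mvb|exact: mvb| |].
    by rewrite !side_mv eqxx; split; exact: nz.
  have x1 : x 0 1 = P 0 1 by rewrite xk -PQ1; ring.
  rewrite /crosses /passes /above -PQ1 !eqxx /= !mxE eqxx x1 eqxx /=.
  have -> : (P 0 1 + e / 2 < P 0 1) = false by apply/negbTE; rewrite -leNgt; lra.
  have -> : P 0 1 - e / 2 < P 0 1 by lra.
  rewrite !andbF !andbT /=.
  have -> : (x 0 0 < Q 0 0) = ~~ (x 0 0 < P 0 0); last by case: (x 0 0 < P 0 0).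
  rewrite xk; move: PQ0; rewrite subr_eq0 eq_sym => PQ0.
  have [h|h|h] := ltgtP (P 0 0) (Q 0 0); last by rewrite h eqxx in PQ0.
    have -> : (1 - t) * P 0 0 + t * Q 0 0 < Q 0 0 by nra.
    by apply/esym; rewrite -leNgt; nra.
  have -> : (1 - t) * P 0 0 + t * Q 0 0 < P 0 0 by nra.
  by apply/negbTE; rewrite -leNgt; nra.
(* Otherwise [x] is moved left and right at its own height, strictly between those of the endpoints:
   no vertex passes, and the edge is crossed from the left only. *)
have PQ1' : - (Q 0 1 - P 0 1) != 0 by rewrite oppr_eq0 subr_eq0 eq_sym.
exists (mv 0 (e / 2)), (mv 0 (- (e / 2))); split; [exact: mvb|exact: mvb| |].
  by rewrite !side_mv /=; split; exact: nz.
have nP : P 0 1 != x 0 1.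
  by apply/eqP => h; apply: (nz _ t PQ1'); [rewrite gt_eqF|move: h; rewrite xk; lra].
have nQ : Q 0 1 != x 0 1.
  apply/eqP => h; apply: (nz _ (1 - t) PQ1'); first by rewrite gt_eqF ?subr_gt0.
  move: h; rewrite xk; lra.
rewrite /passes (negbTE nP) (negbTE nQ) /= !addbF /crosses !side_mv /= /above !mxE /= addr0.
have [h|h|h] := ltgtP (P 0 1) (Q 0 1); last by rewrite h eqxx in PQ1.
  have -> : x 0 1 < Q 0 1 by rewrite xk; nra.
  have -> : (x 0 1 < P 0 1) = false by apply/negbTE; rewrite -leNgt xk; nra.
  rewrite /=.
  have -> : (0 < - (Q 0 1 - P 0 1) * (e / 2)) = false by apply/negbTE; rewrite -leNgt; nra.
  by have -> : 0 < - (Q 0 1 - P 0 1) * - (e / 2) by nra.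
have -> : x 0 1 < P 0 1 by rewrite xk; nra.
have -> : (x 0 1 < Q 0 1) = false by apply/negbTE; rewrite -leNgt xk; nra.
rewrite /=.
have -> : (- (Q 0 1 - P 0 1) * (e / 2) < 0) = false by apply/negbTE; rewrite -leNgt; nra.
by have -> : - (Q 0 1 - P 0 1) * - (e / 2) < 0 by nra.
Qed.

(** * Nets for polygons *)

Lemma outer_measure_bigcup_ord (R : realType) (X : Type)
    (mu : {outer_measure set X -> \bar R}) (n : nat) (F : 'I_n -> set X) (c : R) :
  (forall i, (mu (F i) <= c%:E)%E) -> (mu (\bigcup_i F i) <= (n%:R * c)%:E)%E.
Proof.
move=> Fc; pose G k := if insub k is Some i then F i else set0.
apply: le_trans (_ : mu (\big[setU/set0]_(k < n) G k) <= _)%E.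
  apply: le_outer_measure => x [i _ Fx].
  by rewrite -bigcup_mkord; exists (val i) => //=; rewrite /G valK.
apply: le_trans (outer_measure_subadditive mu G n) _.
apply: le_trans (_ : \sum_(i < n) c%:E <= _)%E.
  by apply: lee_sum => i _; rewrite /G valK.
by rewrite sumEFin sumr_const card_ord mulr_natl.
Qed.

(** About a point [z] where [side] is -1, the function [side] + 1 is homogeneous of degree 1, and
    the slab is where it is within t of 1, so [shell_le] applies. Such a [z] is found at distance
    1/|q - p| from [p] along the normal; the lower bound on the edge length keeps it bounded. *)
Lemma slab_le (R : realType) (N : R) : 0 <= N ->
  exists2 C : R, 0 <= C & forall (p q : 'rV[R]_2) (t : R),
    cube N p -> cube N q ->
    1 <= N * ((q 0 0 - p 0 0) ^+ 2 + (q 0 1 - p 0 1) ^+ 2) -> 0 < t ->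
    (lebesgue_measure_rV (cube N `&` [set x | (`|side p q x| <= t)%R]) <= (C * t)%:E)%E.
Proof.
move=> N0; pose M := N + 2 * N * N; pose rho := N + M + 1.
have M0 : 0 <= M by rewrite /M addr_ge0// !mulr_ge0.
have rho0 : 0 < rho by rewrite /rho; lra.
have rM0 : 0 <= rho + M by lra.
have [C C0 hC] := shell_le 1 rM0.
exists C => // p q t pN qN hL t0.
set L := _ + _ in hL.
have L0 : 0 < L by nra.
have LN : L^-1 <= N by rewrite -div1r ler_pdivrMr.
pose z : 'rV[R]_2 := \row_j if j == 0 then p 0 0 + (q 0 1 - p 0 1) / L
  else p 0 1 - (q 0 0 - p 0 0) / L.
have z0 : z 0 0 = p 0 0 + (q 0 1 - p 0 1) / L by rewrite mxE.
have z1 : z 0 1 = p 0 1 - (q 0 0 - p 0 0) / L by rewrite mxE.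
have sz : side p q z = -1.
  rewrite /side z0 z1 /L; field; rewrite -/L; lra.
have zM : cube M z.
  have aux (a u v w : R) : `|a| <= N -> `|u| <= N -> `|v| <= N ->
      w = a + (u - v) / L -> `|w| <= M.
    move=> aN uN vN ->; rewrite (le_trans (ler_normD _ _))// lerD//.
    rewrite normrM (gtr0_norm (_ : 0 < L^-1)) ?invr_gt0//.
    apply: ler_pM => //; first by rewrite invr_ge0 ltW.
    by apply: le_trans (ler_normB _ _) _; lra.
  move=> [[|[|//]] i2].
    rewrite (_ : Ordinal i2 = 0); last exact/val_inj.
    exact: aux (pN 0) (qN 1) (pN 1) z0.
  rewrite (_ : Ordinal i2 = 1); last exact/val_inj.
  by apply: aux (pN 1) (pN 0) (qN 0) _; rewrite z1; ring.
clearbody z.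
(* The other four functions confine the body to the square of half-side [rho] about [z], large
   enough to contain [cube N]. *)
pose f (j : option ('I_2 * bool)) (x : 'rV[R]_2) : R := match j with
  | None => side p q x + 1
  | Some (k, b) => (if b then rho^-1 else - rho^-1) * (x 0 k - z 0 k) end.
have hf : homogeneous_at f (fun=> 1%N) z.
  split=> // [[[k b]|]|[[k b]|] s x s0] /=.
  - apply: continuous_mul; first exact: continuous_const.
    by apply: continuous_add; [exact: continuous_coord|exact: continuous_const].
  - by apply: continuous_add; [exact: side_continuous|exact: continuous_const].
  - rewrite expr1 !mxE; ring.
  - have -> : dilation z s x = segment_point z x s.
      by apply/rowP => k; rewrite !mxE; ring.
    rewrite side_segment_point sz expr1; ring.
have sub : [set x | forall j, f j x <= 1] `<=` cube (rho + M).
  move=> x h k; have := h (Some (k, true)); have := h (Some (k, false)) => /=.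
  rewrite mulNr lerNl => h1 h2.
  have := zM k; rewrite !ler_norml => /andP[h3 h4].
  move: h1 h2; rewrite mulrC ler_pdivlMr// ler_pdivrMr// => h1 h2.
  by apply/andP; split; lra.
apply: le_trans (hC _ f (fun=> 1%N) z t hf sub t0).
apply: le_lebesgue_rV => x [xN xt]; split.
  by move=> k; apply: le_trans (xN k) _; rewrite /rho; lra.
move: xt; rewrite /= ler_norml => /andP[x1 x2]; split; last by exists None => /=; lra.
move=> [[k b]|] /=; last lra.
apply: le_trans (_ : 1 <= _); last lra.
have := zM k; have := xN k; rewrite !ler_norml => /andP[? ?] /andP[? ?].
case: b; rewrite ?mulNr -?mulrN mulrC ler_pdivrMr// /rho; lra.
Qed.

Lemma region_sign_cell (R : realType) (n : nat) (p : 'I_n -> 'rV[R]_2) (x y : 'rV[R]_2) :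
  (forall i, side (p i) (p (ordS i)) x != 0) ->
  (forall i, side (p i) (p (ordS i)) y != 0) ->
  (forall i, (0 < side (p i) (p (ordS i)) x) = (0 < side (p i) (p (ordS i)) y)) ->
  polygon_region p x <-> polygon_region p y.
Proof.
move=> nx ny xy; apply: region_segment => t /andP[t0 t1] /polygon_curveE[i [u _ E]].
have : side (p i) (p (ordS i)) (segment_point x y t) = 0.
  by rewrite -E side_segment_point /side; ring.
rewrite side_segment_point; have := xy i; have := nx i; have := ny i.
set a := side _ _ x; set b := side _ _ y => b0 a0 ab.
have [ha|ha] := ltP 0 a; [rewrite ha in ab|rewrite ltNge ha /= in ab].
  by have hb : 0 < b by []; nra.
have hb : b < 0 by rewrite lt_neqAle b0 leNgt -ab.
have ha' : a < 0 by rewrite lt_neqAle a0.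
nra.
Qed.

(** The discrete datum is the set of sign vectors realized by the polygon off its edge lines; a net
    set consists of the points of the cube with such a sign vector for the perturbed lines. Outside
    [n] thin slabs around the true lines, a perturbation does not change the sign vector. *)
Lemma covered_polygons (R : realType) (n : nat) (N : nat) :
  covered_with_exponent (@lebesgue_measure_rV R 2) (n * 2)
    [set A | exists p : 'I_n -> 'rV[R]_2, [/\ A = polygon_region p,
      forall i, cube N%:R (p i) &
      forall i, 1 <= N%:R * ((p (ordS i) 0 0 - p i 0 0) ^+ 2 +
                             (p (ordS i) 0 1 - p i 0 1) ^+ 2)]].
Proof.
pose P : finType := ('I_n * 'I_2)%type.
have -> : (n * 2 = #|P|)%N by rewrite card_prod !card_ord.
pose pt (theta : P -> R) i : 'rV[R]_2 := \row_j theta (i, j).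
pose g i (theta : P -> R) x := side (pt theta i) (pt theta (ordS i)) x.
have N0 : 0 <= N%:R :> R by [].
have [C' C'0 hC'] := slab_le N0.
have lg i : param_lipschitz (g i).
  pose h (i j : 'I_n) (k l : 'I_2) (theta : P -> R) (x : 'rV[R]_2) :=
    (theta (j, k) - theta (i, k)) * (x 0 l - theta (i, l)).
  have lh i' j k l : param_lipschitz (h i' j k l).
    apply: param_lipschitzM; apply: param_lipschitzD.
    - exact: param_lipschitz_param.
    - exact/param_lipschitzN/param_lipschitz_param.
    - exact: param_lipschitz_coord.
    - exact/param_lipschitzN/param_lipschitz_param.
  have -> : g i = fun theta x => h i (ordS i) 0 1 theta x + - h i (ordS i) 1 0 theta x.
    by apply/funext => theta; apply/funext => x; rewrite /g /side !mxE.
  exact: param_lipschitzD (lh _ _ _ _) (param_lipschitzN (lh _ _ _ _)).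
have /choice[c hc] : forall i, exists C : R, 0 <= C /\ forall theta theta' x eps,
    (forall p, `|theta p| <= N%:R + 1) -> (forall p, `|theta' p| <= N%:R + 1) ->
    (forall p, `|theta' p - theta p| <= eps) -> cube (N%:R + 1) x -> 0 <= eps ->
    `|g i theta x| <= C /\ `|g i theta' x - g i theta x| <= C * eps.
  by move=> i; have [C C0 hC] := lg i (N%:R + 1); exists C; split.
pose C := 1 + \sum_i c i.
have cC i : c i <= C.
  rewrite /C (bigD1 i)//= addrCA lerDl addr_ge0// sumr_ge0// => j _.
  by have [] := hc j.
have C0 : 0 < C by rewrite ltr_pwDl// sumr_ge0// => i _; have [] := hc i.
pose sgn theta x : {ffun 'I_n -> bool} := [ffun i => 0 < g i theta x].
apply: (@covered_of_lipschitz _ _ _ P {set {ffun 'I_n -> bool}} _ (fun s theta =>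
  cube N%:R `&` [set x | sgn theta x \in s]) N%:R (n%:R * (C' * C))).
move=> A [p [EA pN pL]].
pose theta (ij : P) := p ij.1 0 ij.2.
have ptE i : pt theta i = p i by apply/rowP => j; rewrite mxE.
pose nz x := forall i, side (p i) (p (ordS i)) x != 0.
exists [set sigma | `[< exists x, [/\ A x, nz x & sigma = sgn theta x] >]]%SET, theta.
split=> [ij|eps theta' eps0 eps1 close]; first exact: pN.
have ht p' : `|theta p'| <= N%:R + 1.
  by apply: le_trans (pN p'.1 p'.2) _; rewrite lerDl.
have ht' p' : `|theta' p'| <= N%:R + 1.
  rewrite -(subrK (theta p') (theta' p')) addrC (le_trans (ler_normD _ _))//.
  by rewrite lerD ?(pN p'.1 p'.2)// (le_trans (close p')).
have near x i : cube N%:R x -> `|g i theta' x - g i theta x| <= C * eps.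
  move=> hx; have [_ h] := hc i.
  have [|_ {}h] := h theta theta' x eps ht ht' close _ (ltW eps0).
    by move=> k; rewrite (le_trans (hx k))// lerDl.
  by rewrite (le_trans h)// ler_wpM2r// ltW.
have gE i x : g i theta x = side (p i) (p (ordS i)) x by rewrite /g !ptE.
have Ce : 0 < C * eps by rewrite mulr_gt0.
rewrite -mulrA -[C' * C * eps]mulrA.
apply: le_trans (@outer_measure_bigcup_ord _ _ _ n (fun i =>
  cube N%:R `&` [set x | `|side (p i) (p (ordS i)) x| <= C * eps]) _ _); last first.
  by move=> i; exact: hC'.
have AN : A `<=` cube N%:R by rewrite EA; exact: polygon_region_cube.
have key x : cube N%:R x -> (forall i, ~ `|side (p i) (p (ordS i)) x| <= C * eps) ->
    (A x <-> sgn theta' x \in [set sigma | `[< exists x, [/\ A x, nz x & sigma = sgn theta x] >]]%SET).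
  move=> xN far.
  have nzx : nz x.
    by move=> i; apply/eqP => E; apply: (far i); rewrite E normr0 ltW.
  have sE : sgn theta' x = sgn theta x.
    apply/ffunP => i; rewrite !ffunE; have := near x i xN; rewrite gE.
    have := far i => /negP; rewrite -ltNge ler_norml ltr_normr.
    move=> /orP[h|h] /andP[h1 h2].
      by apply/idP/idP => _; lra.
    by apply/idP/idP => ?; lra.
  rewrite sE inE; split=> [Ax|/asboolP[w [Aw nzw sw]]].
    by apply/asboolP; exists x.
  move: Aw; rewrite EA; apply: (region_sign_cell nzw nzx _).1 => i.
  by have /ffunP/(_ i) := sw; rewrite !ffunE !gE.
apply: le_lebesgue_rV => x [[Ax nDx]|[[xN Dx] nAx]].
  have xN := AN x Ax; apply: contrapT => nU; apply: nDx; split=> //.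
  by apply/(key x xN _).1 => // i h; apply: nU; exists i.
apply: contrapT => nU; apply: nAx; apply/(key x xN _).2 => // i h.
by apply: nU; exists i.
Qed.

Lemma reconstructible_polygons (R : realType) (n : nat) : (3 <= n)%N ->
  reconstructible (@lebesgue_measure_rV R 2) (@polygons R n) (4 * n + 1)%N.
Proof.
move=> n3; have n1 : (1 < n)%N by exact: ltnW.
pose G (N : nat) := [set A | exists p : 'I_n -> 'rV[R]_2, [/\ A = polygon_region p,
      forall i, cube N%:R (p i) &
      forall i, 1 <= N%:R * ((p (ordS i) 0 0 - p i 0 0) ^+ 2 +
                             (p (ordS i) 0 1 - p i 0 1) ^+ 2)]].
have GW N N' A : (N <= N')%N -> G N A -> G N' A.
  move=> NN' [p [EA pN pL]]; exists p; split=> // i.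
    by move=> j; apply: le_trans (pN i j) _; rewrite ler_nat.
  by apply: le_trans (pL i) _; rewrite ler_wpM2r ?addr_ge0 ?sqr_ge0 ?ler_nat.
have PG A : polygons n A -> exists N, G N A.
  move=> [p [sp EA]].
  pose L i := (p (ordS i) 0 0 - p i 0 0) ^+ 2 + (p (ordS i) 0 1 - p i 0 1) ^+ 2.
  have L0 i : 0 < L i.
    rewrite lt_neqAle addr_ge0 ?sqr_ge0// andbT eq_sym.
    rewrite paddr_eq0 ?sqr_ge0// !sqrf_eq0 !subr_eq0; apply/negP => /andP[/eqP h0 /eqP h1].
    by apply: (simple_polygon_neq (i := i) n1 sp); apply: rV2P.
  (* A single number bounding both the coordinates and the inverse squared edge lengths. *)
  pose S := \sum_i ((L i)^-1 + \sum_j `|p i 0 j|).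
  have S0 i : 0 <= (L i)^-1 + \sum_j `|p i 0 j|.
    by rewrite addr_ge0 ?invr_ge0 ?(ltW (L0 i))// sumr_ge0.
  have SN : S <= (Num.bound S)%:R.
    by apply/ltW/(le_lt_trans (ler_norm S)); exact: unstable.ltr_norm_bound.
  have Si i : (L i)^-1 + \sum_j `|p i 0 j| <= S.
    by rewrite /S (bigD1 i)//= lerDl sumr_ge0.
  exists (Num.bound S), p; split=> // i.
    move=> j; apply: le_trans SN; apply: le_trans (Si i).
    rewrite (bigD1 j)//= addrCA lerDl addr_ge0 ?invr_ge0 ?(ltW (L0 i))// sumr_ge0//.
  rewrite -[X in 1 <= _ * X]/(L i) -ler_pdivrMr ?L0// mul1r; apply: le_trans SN; apply: le_trans (Si i).
  by rewrite lerDl sumr_ge0.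
apply: (@reconstructible_regular R 1 (n * 2) _ _ G).
- lia.
- move=> A B /PG[N NA] /PG[N' NB]; exists (N + N')%N; split.
    exact: GW (leq_addr _ _) NA.
  exact: GW (leq_addl _ _) NB.
- by move=> N; exact: covered_polygons.
move=> _ [p [sp ->]]; split; first exact: polygon_region_closed.
move=> x rx; have [cx|ncx] := pselect (polygon_curve p x).
  exact: curve_sub_closure_interior cx.
by apply: subset_closure; exact: polygon_region_interior.
Qed.

Theorem corollary7p4 (R : realType) :
  reconstructible (@lebesgue_measure R) (@intervals R) 5 /\
  (forall d : nat, (1 <= d)%N ->
     reconstructible (@lebesgue_measure_rV R d) (@balls R d) (2 * d + 3)%N) /\
  (forall n : nat, (3 <= n)%N ->
     reconstructible (@lebesgue_measure_rV R 2) (@polygons R n)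
       (4 * n + 1)%N) /\
  reconstructible (@lebesgue_measure_rV R 2) (@axis_rectangles R) 9 /\
  reconstructible (@lebesgue_measure_rV R 3) (@ellipsoids R 3) 19 /\
  (forall d : nat, (1 <= d)%N ->
     reconstructible (@lebesgue_measure_rV R d) (@simplices R d)
       (2 * d ^ 2 + 2 * d + 1)%N).
Proof.
split; first exact: reconstructible_intervals.
split; first by move=> [//|d] _; exact: reconstructible_balls.
split; first exact: reconstructible_polygons.
split; first exact: reconstructible_rectangles.
split; first exact: reconstructible_ellipsoids.
by move=> [//|d] _; exact: reconstructible_simplices.
Qed.
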